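(* Let $\boldsymbol v_{\mathrm{Mi}}=\min_{\delta\in(0,1)}\frac{\arccos\delta}{\sqrt{1-\delta^2}}\cdot 2\sqrt{1+\delta^2}=2.7014285\ldots$. Then $$\Gamma^{\mathrm{Lie}}(\boldsymbol v_{\mathrm{Mi}},\boldsymbol v_{\mathrm{Mi}})=+\infty .$$ In particular, $$\mathrm C^{\mathrm{Lie}}_2\leq\mathrm D^{\mathrm{Lie}}_2\leq 2\boldsymbol v_{\mathrm{Mi}}=5.4028570\ldots .$$
   Context: A Lie monomial is an iterated bracket of generators (the generators themselves included). For an element $P$ of the free Lie algebra over $\mathbb R$ generated by $Y_1,Y_2$, $$\|P\|_{\ell^1}=\inf\Big\{\sum_j|\theta_j| : P=\sum_j\theta_jM_j \text{ (finite sum)},\ \theta_j\in\mathbb R,\ M_j \text{ Lie monomials}\Big\}.$$ Let $\mathrm{BCH}(Y_1,Y_2)=\log(\exp(Y_1)\exp(Y_2))$ as a formal series of Lie polynomials, and let $\mathrm{BCH}_{n_1,n_2}(Y_1,Y_2)$ be its component homogeneous of degree $n_1$ in $Y_1$ and of degree $n_2$ in $Y_2$. For $x_1,x_2\ge0$ put $$\Gamma^{\mathrm{Lie}}(x_1,x_2)=\sum_{n_1+n_2\ge1}\|\mathrm{BCH}_{n_1,n_2}(Y_1,Y_2)\|_{\ell^1}\,x_1^{n_1}x_2^{n_2}\in[0,+\infty].$$ The cumulative convergence radius and the diagonal convergence radius are $$\mathrm C^{\mathrm{Lie}}_2=\sup\Big\{ x\in[0,+\infty)\,:\,\max_{0\leq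 x_1,x_2,\ x_1+x_2\leq x} \Gamma^{\mathrm{Lie}}(x_1,x_2) <+\infty \Big\},\qquad \mathrm D^{\mathrm{Lie}}_2=\sup\Big\{ x\in[0,+\infty)\,:\, \Gamma^{\mathrm{Lie}}\big(\tfrac x2,\tfrac x2\big) <+\infty \Big\}.$$ The minimum defining $\boldsymbol v_{\mathrm{Mi}}$ is attained at $\delta_{\mathrm{Mi}}=0.55088194\ldots$, the solution of $\frac{2\delta\arccos\delta}{(1+\delta^2)\sqrt{1-\delta^2}}=1$ in $(0,1)$. *)

(* Defs.v *)
From HB Require Import structures.
From mathcomp Require Import all_boot all_order all_algebra.
From mathcomp Require Import all_classical all_reals all_analysis.

Set Implicit Arguments.
Unset Strict Implicit.
Unset Printing Implicit Defensive.

Import Order.TTheory GRing.Theory Num.Theory.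
Import numFieldNormedType.Exports.

Local Open Scope classical_set_scope.
Local Open Scope ring_scope.

(* Formal power series in noncommuting variables indexed by T, given by their
   coefficients on words. The type is a separate constant because plain
   functions already carry the pointwise product, which is not the product
   wanted here. *)
Definition ncseries (T : Type) (R : Type) : Type := seq T -> R.

HB.instance Definition _ (T : Type) (R : comNzRingType) :=
  GRing.Lmodule.copy (ncseries T R) (seq T -> R^o).

Section NCSeries.
Context {T : Type} {R : comNzRingType}.
Implicit Types f g h : ncseries T R.

Definition ncseries_one : ncseries T R := fun w => (nilp w)%:R.

Definition ncseries_mul f g : ncseries T R :=
  fun w => \sum_(i < (size w).+1) f (take i w) * g (drop i w).

Lemma ncseriesDE f g w : (f + g) w = f w + g w. Proof. by []. Qed.

Lemma ncseriesZE (c : R) f w : (c *: f) w = c * f w. Proof. by []. Qed.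

Let shift (a : T) f : ncseries T R := fun w => f (a :: w).

Let mul_nil f g : ncseries_mul f g [::] = f [::] * g [::].
Proof. by rewrite /ncseries_mul big_ord_recl big_ord0 addr0. Qed.

Let mul_cons f g a w :
  ncseries_mul f g (a :: w) =
  f [::] * g (a :: w) + ncseries_mul (shift a f) g w.
Proof. by rewrite /ncseries_mul big_ord_recl. Qed.

Lemma ncseries_mulDl : left_distributive ncseries_mul +%R.
Proof.
move=> f g h; apply/funext => w; rewrite ncseriesDE /ncseries_mul -big_split.
by apply: eq_bigr => i _; rewrite mulrDl.
Qed.

Lemma ncseries_mulDr : right_distributive ncseries_mul +%R.
Proof.
move=> f g h; apply/funext => w; rewrite ncseriesDE /ncseries_mul -big_split.
by apply: eq_bigr => i _; rewrite mulrDr.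
Qed.

Lemma ncseries_scalerAl (c : R) f g :
  c *: ncseries_mul f g = ncseries_mul (c *: f) g.
Proof.
apply/funext => w; rewrite ncseriesZE /ncseries_mul.
by rewrite mulr_sumr; apply: eq_bigr => i _; rewrite mulrA.
Qed.

Lemma ncseries_scalerAr (c : R) f g :
  c *: ncseries_mul f g = ncseries_mul f (c *: g).
Proof.
apply/funext => w; rewrite ncseriesZE /ncseries_mul.
by rewrite mulr_sumr; apply: eq_bigr => i _; rewrite mulrCA.
Qed.

Lemma ncseries_mulA : associative ncseries_mul.
Proof.
move=> f g h; apply/funext => w.
elim: w f g h => [|a w IH] f g h; first by rewrite !mul_nil mulrA.
rewrite !mul_cons mul_nil mulrDr mulrA -addrA; congr (_ + _).
rewrite IH.
have -> : shift a (ncseries_mul f g) =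
  f [::] *: shift a g + ncseries_mul (shift a f) g :> ncseries T R.
  by apply/funext => v; rewrite /shift mul_cons.
by rewrite ncseries_mulDl -ncseries_scalerAl.
Qed.

Lemma ncseries_mul1l : left_id ncseries_one ncseries_mul.
Proof.
move=> f; apply/funext => w; rewrite /ncseries_mul big_ord_recl take0 drop0.
rewrite mul1r big1 ?addr0// => i _.
by case: w i => [|a w] i; [case: i|rewrite /= mul0r].
Qed.

Lemma ncseries_mul1r : right_id ncseries_one ncseries_mul.
Proof.
move=> f; apply/funext => w; rewrite /ncseries_mul big_ord_recr /=.
rewrite take_size drop_size mulr1 big1 ?add0r// => i _.
by rewrite /ncseries_one /nilp size_drop subn_eq0 leqNgt ltn_ord mulr0.
Qed.

Lemma ncseries_oner_neq0 : ncseries_one != 0.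
Proof.
apply/eqP => /(congr1 (fun f : ncseries T R => f [::])) /eqP.
by rewrite [_ == _](oner_eq0 R).
Qed.

End NCSeries.

HB.instance Definition _ (T : Type) (R : comNzRingType) :=
  GRing.Zmodule_isNzRing.Build (ncseries T R)
    ncseries_mulA ncseries_mul1l ncseries_mul1r
    ncseries_mulDl ncseries_mulDr ncseries_oner_neq0.

HB.instance Definition _ (T : Type) (R : comNzRingType) :=
  GRing.Lmodule_isLalgebra.Build R (ncseries T R) ncseries_scalerAl.

HB.instance Definition _ (T : Type) (R : comNzRingType) :=
  GRing.Lalgebra_isAlgebra.Build R (ncseries T R) ncseries_scalerAr.

(* If f has no constant term then f ^+ k only involves words of length at
   least k: this is why the coefficientwise sums in ncexp and nclog below can
   be cut at the length of the word. *)
Lemma ncseries_expr_small (T : Type) (R : comNzRingType) (f : ncseries T R)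
    (k : nat) (w : seq T) :
  f [::] = 0 -> (size w < k)%N -> (f ^+ k) w = 0.
Proof.
move=> f0; elim: k w => // k IH w wk.
rewrite exprS [LHS]/(ncseries_mul f (f ^+ k) w) /ncseries_mul big1// => i _.
case: (posnP i) => [->|i_gt0]; first by rewrite take0 f0 mul0r.
rewrite IH ?mulr0// size_drop; apply: (@leq_trans (size w)) => //.
by rewrite ltn_subrL i_gt0 (leq_trans i_gt0) // -ltnS.
Qed.

Section ExpLog.
Context {T : eqType} {R : realType}.

Definition ncvar (i : T) : ncseries T R := fun w => (w == [:: i])%:R.

(* Only meaningful for f with zero constant term. *)
Definition ncexp (f : ncseries T R) : ncseries T R :=
  fun w => \sum_(0 <= k < (size w).+1) k`!%:R^-1 * (f ^+ k) w.

(* Only meaningful for g with constant term 1. *)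
Definition nclog (g : ncseries T R) : ncseries T R :=
  fun w => \sum_(1 <= k < (size w).+1)
    (-1) ^+ k.-1 / k%:R * ((g - 1) ^+ k) w.

Definition lie_bracket (P Q : ncseries T R) : ncseries T R := P * Q - Q * P.

End ExpLog.

Section LieNorm.
Context {T : eqType} {R : realType}.

(* The free Lie algebra on T is realized, as usual, inside the free
   associative algebra on T (the finitely supported series), as the real span
   of the Lie monomials in the variables. *)
Inductive lie_monomial : ncseries T R -> Prop :=
| lie_monomial_var i : lie_monomial (ncvar i)
| lie_monomial_bracket P Q :
    lie_monomial P -> lie_monomial Q -> lie_monomial (lie_bracket P Q).

(* The value is +oo (infimum of the empty set) when P is not a Lie
   polynomial. *)
Definition lie_l1norm (P : ncseries T R) : \bar R :=
  ereal_inf [set s : \bar R |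
    exists (n : nat) (theta : 'I_n -> R) (M : 'I_n -> ncseries T R),
      [/\ forall j, lie_monomial (M j),
          P = \sum_(j < n) theta j *: M j &
          s = (\sum_(j < n) `|theta j|)%:E]].

End LieNorm.

Section BCH.
Context {R : realType}.

Definition Y1 : ncseries 'I_2 R := ncvar ord0.
Definition Y2 : ncseries 'I_2 R := ncvar ord_max.

Definition BCH : ncseries 'I_2 R := nclog (ncexp Y1 * ncexp Y2).

Definition BCH_comp (n1 n2 : nat) : ncseries 'I_2 R :=
  fun w => if (count_mem ord0 w == n1) && (count_mem ord_max w == n2)
           then BCH w else 0.

Definition GammaLie (x1 x2 : R) : \bar R :=
  \esum_(n in [set n : nat * nat | (1 <= n.1 + n.2)%N])
    (lie_l1norm (BCH_comp n.1 n.2) * (x1 ^+ n.1 * x2 ^+ n.2)%:E)%E.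

End BCH.

Section Radii.
Variable R : realType.

Definition triangle (x : R) : set (R * R) :=
  [set y | [/\ 0 <= y.1, 0 <= y.2 & y.1 + y.2 <= x]].

(* The maximum over the triangle is written as a supremum in [0, +oo]. *)
Definition CLie2 : \bar R :=
  ereal_sup [set x%:E | x in [set x : R | 0 <= x /\
    (ereal_sup [set GammaLie y.1 y.2 | y in triangle x] < +oo)%E]].

Definition DLie2 : \bar R :=
  ereal_sup [set x%:E | x in [set x : R | 0 <= x /\
    (GammaLie (x / 2)%R (x / 2)%R < +oo)%E]].

End Radii.

Section MinimalValue.
Variable R : realType.

Definition vMi_fun (delta : R) : R :=
  acos delta / Num.sqrt (1 - delta ^+ 2) * (2 * Num.sqrt (1 + delta ^+ 2)).

Definition is_minimum (A : set R) (v : R) : Prop := A v /\ lbound A v.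

(* d.d_1...d_m as the list [:: d; d_1; ...; d_m] *)
Definition decimal (ds : seq nat) : R :=
  \sum_(i < size ds) (nth 0%N ds i)%:R / 10 ^+ i.

(* v = d.d_1...d_m followed by further decimals *)
Definition decimal_digits (ds : seq nat) (v : R) : Prop :=
  decimal ds <= v < decimal ds + (10 ^+ (size ds).-1)^-1.

End MinimalValue.

(* Main.v *)
Require Import Defs.
From mathcomp Require Import all_boot all_order all_algebra.
From mathcomp Require Import all_classical all_reals all_analysis.
From mathcomp Require Import ring lra zify.

(* Equip sl_2(R) with the norm N(A)^2 = 2 (sum of the squares of the entries),
   for which N([A, B]) <= N(A) N(B). A Lie monomial of degree n evaluated at
   matrices of norm at most v has norm at most v^n, so if GammaLie v v were
   finite, the Lie series BCH would converge absolutely at any X, Y of norm v,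
   to a traceless L with exp L = exp X exp Y. For delta = cos s with
   0 < s < pi / 2 take
     X = 1/2 [[b, -a], [a, -b]],  Y = 1/2 [[-b, -a], [a, b]],
     a^2 + b^2 = v^2,  a^2 - b^2 = 4 s^2.
   Then X^2 = Y^2 = -s^2, and the trace of exp X exp Y is -2 exactly when
   v = vMi_fun delta, while exp X exp Y is not -1. No exponential of a real
   traceless 2x2 matrix is of this kind.

   The digits come from the sign of s - (c / 2) sin s / sqrt (1 + cos^2 s),
   whose derivative has the sign of (1 + u)^3 - c^2 u, convex in u = cos^2 s;
   everything is thereby reduced to Taylor bounds of cos at the near-minimizer
   78/79 and at 4937/5000. *)

Set Implicit Arguments.
Unset Strict Implicit.
Unset Printing Implicit Defensive.

Import Order.TTheory GRing.Theory Num.Theory.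
Import numFieldNormedType.Exports.

Local Open Scope classical_set_scope.
Local Open Scope ring_scope.

(** * Formal exponential and logarithm *)

Section TruncatedExpLog.
Variable F : numFieldType.

(** The truncation at degree [N] of log (1 + X). *)
Definition logp (N : nat) : {poly F} :=
  \sum_(1 <= k < N.+1) ((-1) ^+ k.-1 / k%:R) *: 'X^k.

Definition expp (N : nat) (p : {poly F}) : {poly F} :=
  \sum_(0 <= k < N.+1) k`!%:R^-1 *: p ^+ k.

Lemma deriv_logp N : ('X + 1) * (logp N)^`() = 1 - (- 'X) ^+ N.
Proof.
have -> : (logp N)^`() = \sum_(i < N) (- 'X) ^+ i.
  rewrite /logp big_add1 /= big_mkord raddf_sum; apply: eq_bigr => i _ /=.
  rewrite linearZ /= derivXn -[X in _ *: X]scaler_nat scalerA.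
  rewrite divfK ?pnatr_eq0// -[in RHS]mulN1r exprMn.
  by rewrite -mul_polyC rmorphXn /= rmorphN1.
have := subrXX (1 : {poly F}) (- 'X) N; rewrite expr1n opprK addrC => ->.
by rewrite addrC; congr (_ * _); apply: eq_bigr => i _; rewrite expr1n mul1r.
Qed.

Lemma deriv_expp N (p : {poly F}) :
  (expp N p)^`() = p^`() * (expp N p - N`!%:R^-1 *: p ^+ N).
Proof.
rewrite /expp [in RHS]big_nat_recr//= addrK big_nat_recl//= derivD expr0.
rewrite linearZ /= derivC scaler0 add0r raddf_sum mulr_sumr.
apply: eq_bigr => i _ /=.
rewrite linearZ /= deriv_exp /= -[X in _ *: X]scaler_nat scalerA.
rewrite -scalerAr; congr (_ *: _).
by rewrite factS natrM invfM mulrAC mulVf ?pnatr_eq0// mul1r.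
Qed.

Lemma coef0_logp N : (logp N)`_0 = 0.
Proof.
rewrite /logp coef_sum big_add1 /= big1// => i _.
by rewrite coefZ coefXn /= mulr0.
Qed.

(** The composite e satisfies (1 + X) e' = e modulo X^N, that is (j + 1) e_(j+1) = (1 - j) e_j for j
    < N; with e_0 = 1 this recurrence forces 1 + X. *)
Lemma coef_expp_logp N i : (i <= N)%N -> (expp N (logp N))`_i = (i <= 1)%:R.
Proof.
set e := expp N (logp N).
have low (q : {poly F}) j : (j < N)%N -> (logp N ^+ N * q)`_j = 0.
  move=> jN; have [m ->] : exists m, logp N = m * 'X.
    have /factor_theorem[m ->] : root (logp N) 0.
      by rewrite rootE horner_coef0 coef0_logp.
    by exists m; rewrite subr0.
  by rewrite exprMn mulrAC coefMXn jN.
have step j : (j < N)%N -> e`_j.+1 *+ j.+1 + e`_j *+ j = e`_j.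
  move=> jN.
  have : (('X + 1) * e^`())`_j = e`_j.
    rewrite deriv_expp mulrA deriv_logp -/e.
    set q := _ - _ *: _; rewrite mulrBl mul1r {1}/q -mul_polyC.
    rewrite !coefB [_%:P * _]mulrC low// exprNn mulrAC.
    by rewrite coefMXn jN !subr0.
  rewrite mulrDl mul1r coefD coefXM !coef_deriv.
  case: j jN => [|j] jN /= E; rewrite -[RHS]E.
    by rewrite mulr0n addr0 add0r.
  by rewrite addrC.
elim: i => [_|i IH iN].
  rewrite /e /expp coef_sum big_nat_recl//= big1 => [|i _].
    by rewrite expr0 coefZ coef1 invr1 mul1r addr0.
  rewrite coefZ -horner_coef0 horner_exp horner_coef0 coef0_logp.
  by rewrite expr0n mulr0.
have := step i iN; rewrite IH; last exact: ltnW.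
case: i {IH iN} => [|[|i]].
- by rewrite mulr1n mulr0n addr0.
- by rewrite mulr1n -[X in _ = X]add0r => /addIr /eqP; rewrite mulrn_eq0 /= => /eqP.
- by rewrite /= mulr0n mul0rn addr0 => /eqP; rewrite mulrn_eq0 /= => /eqP.
Qed.

Lemma expp_logp N : (0 < N)%N ->
  exists q, expp N (logp N) = 1 + 'X + q * 'X^(N.+1).
Proof.
move=> N0; exists (drop_poly N.+1 (expp N (logp N))).
rewrite -[LHS](poly_take_drop N.+1); congr (_ + _).
apply/polyP => i; rewrite coef_take_poly coefD coef1 coefX ltnS.
case: leqP => iN; first by rewrite coef_expp_logp//; case: i {iN} => [|[|i]];
  rewrite ?addr0 ?add0r.
by move: (leq_ltn_trans N0 iN); case: i iN => [|[|i]]//=; rewrite addr0.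
Qed.

End TruncatedExpLog.

Section ExpLogSeries.
Variables (T : eqType) (R : realType).
Implicit Types f g u : ncseries T R.

Lemma ncseries_sumE (I : Type) (r : seq I) (P : pred I)
    (f : I -> ncseries T R) w :
  (\sum_(i <- r | P i) f i) w = \sum_(i <- r | P i) f i w.
Proof. by elim/big_rec2: _ => // i _ h _ <-. Qed.

Lemma ncseriesME f g w :
  (f * g) w = \sum_(i < (size w).+1) f (take i w) * g (drop i w).
Proof. by []. Qed.

Definition eq_upto N f g := forall w, (size w <= N)%N -> f w = g w.

Lemma eq_uptoX N f g k : eq_upto N f g -> eq_upto N (f ^+ k) (g ^+ k).
Proof.
move=> fg; elim: k => [|k IH] w wN; first by rewrite !expr0.
rewrite !exprS !ncseriesME; apply: eq_bigr => i _.
rewrite fg ?IH//.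
  by rewrite size_drop (leq_trans (leq_subr _ _)).
by rewrite size_take_min (leq_trans (geq_minr _ _)).
Qed.

(** On words of length at most N both series agree with images of truncated polynomials under X |->
    g - 1, so [expp_logp] applies; its remainder becomes a multiple of (g - 1)^(N+1), which vanishes
    on such words. *)
Lemma ncexp_nclog g : g [::] = 1 -> ncexp (nclog g) = g.
Proof.
move=> g1; apply/funext => w.
have [w0|w_gt0] := posnP (size w).
  by rewrite (size0nil w0) /ncexp /= big_nat1 fact0 invr1 mul1r g1.
pose u := g - 1; pose N := size w.
have u0 : u [::] = 0 by rewrite /u ncseriesDE g1 [X in 1 + X](_ : _ = - 1) ?subrr.
have logE : eq_upto N (nclog g) (horner_alg u (logp R N)).
  move=> v vN; rewrite /logp rmorph_sum /= ncseries_sumE /nclog.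
  rewrite (big_cat_nat (n := (size v).+1) (p := N.+1))//=.
  rewrite [X in _ = _ + X]big_nat_cond [X in _ = _ + X]big1 ?addr0.
    apply: eq_bigr => k _.
    by rewrite linearZ /= rmorphXn /= horner_algX mulr_algl ncseriesZE.
  move=> k; rewrite andbT => /andP[vk _].
  rewrite linearZ /= rmorphXn /= horner_algX mulr_algl ncseriesZE.
  by rewrite ncseries_expr_small ?mulr0.
have -> : ncexp (nclog g) w = horner_alg u (expp N (logp R N)) w.
  rewrite /ncexp /expp rmorph_sum /= ncseries_sumE; apply: eq_bigr => k _.
  by rewrite linearZ /= rmorphXn /= mulr_algl ncseriesZE (eq_uptoX _ logE).
have [q ->] := expp_logp R w_gt0.
rewrite rmorphD rmorphD rmorph1 rmorphM rmorphXn /= horner_algX.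
rewrite [1 + u]addrC subrK ncseriesDE ncseriesME big1 ?addr0// => i _.
by rewrite (ncseries_expr_small u0) ?mulr0// size_drop ltnS leq_subr.
Qed.

End ExpLogSeries.

(** * Evaluation of noncommutative series at matrices *)

Section Evaluation.
Variables (T : finType) (R : realType) (A : algType R) (x : T -> A).
Implicit Types f g : ncseries T R.

Definition cauchy_prod (a b : nat -> A) (n : nat) : A :=
  \sum_(i < n.+1) a i * b (n - i)%N.

Fixpoint cauchy_exp (a : nat -> A) (k : nat) : nat -> A :=
  if k is k'.+1 then cauchy_prod a (cauchy_exp a k') else fun n => (n == 0%N)%:R.

Definition ncseries_shift (a : T) f : ncseries T R := fun w => f (a :: w).

(** The homogeneous part of degree [n] of [f] at [x]: the sum, over the words w of length [n], of
    [f w] times the product of the [x a] along w. *)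
Fixpoint ncseries_eval f (n : nat) : A :=
  if n is m.+1 then \sum_a x a * ncseries_eval (ncseries_shift a f) m
  else f [::] *: 1.

Local Notation ev := ncseries_eval.

Lemma eq_ncseries_eval f g n :
  (forall w, size w = n -> f w = g w) -> ev f n = ev g n.
Proof.
elim: n f g => [|n IH] f g fg /=; first by rewrite fg.
apply: eq_bigr => a _; rewrite (IH _ (ncseries_shift a g))// => w wn.
by apply: fg; rewrite /= wn.
Qed.

Lemma ncseries_evalD f g n : ev (f + g) n = ev f n + ev g n.
Proof.
elim: n f g => [|n IH] f g /=; first by rewrite scalerDl.
by rewrite -big_split /=; apply: eq_bigr => a _; rewrite -mulrDr -IH.
Qed.

Lemma ncseries_evalZ c f n : ev (c *: f) n = c *: ev f n.
Proof.
elim: n f => [|n IH] f /=; first by rewrite scalerA.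
by rewrite scaler_sumr; apply: eq_bigr => a _; rewrite scalerAr -IH.
Qed.

Lemma ncseries_eval0 n : ev 0 n = 0.
Proof. by rewrite -[0 in LHS](scale0r 0) ncseries_evalZ scale0r. Qed.

Lemma ncseries_evalB f g n : ev (f - g) n = ev f n - ev g n.
Proof. by rewrite ncseries_evalD -[- g]scaleN1r ncseries_evalZ scaleN1r. Qed.

Lemma ncseries_eval_sum (I : Type) (r : seq I) (P : pred I)
    (f : I -> ncseries T R) n :
  ev (\sum_(i <- r | P i) f i) n = \sum_(i <- r | P i) ev (f i) n.
Proof.
apply: (big_morph (ev^~ n)); last exact: ncseries_eval0.
by move=> f' g'; exact: ncseries_evalD.
Qed.

(** Induction on the degree, by the first-letter rule: the shift of a product is [f [::]] times the
    shift of [g], plus the shift of [f] times [g]. *)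
Lemma ncseries_evalM f g : ev (f * g) =1 cauchy_prod (ev f) (ev g).
Proof.
move=> n; elim: n f => [|n IH] f.
  rewrite /cauchy_prod big_ord_recl big_ord0 addr0 /= ncseriesME big_ord_recl.
  by rewrite big_ord0 addr0 -scalerAl mul1r scalerA.
rewrite /cauchy_prod big_ord_recl /= -scalerAl mul1r scaler_sumr.
under [X in _ = _ + X]eq_bigr do rewrite mulr_suml.
rewrite exchange_big -big_split; apply: eq_bigr => a _ /=.
rewrite (_ : ncseries_shift a _ =
  f [::] *: ncseries_shift a g + ncseries_shift a f * g).
  rewrite ncseries_evalD ncseries_evalZ IH mulrDr -scalerAr mulr_sumr.
  by congr (_ + _); apply: eq_bigr => i _; rewrite mulrA.
by apply/funext => w; rewrite [LHS](ncseriesME f g (a :: w)) big_ord_recl.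
Qed.

Lemma ncseries_eval1 n : ev 1 n = (n == 0%N)%:R.
Proof.
elim: n => [|n IH] /=; first by rewrite scale1r.
rewrite big1// => a _.
by rewrite (_ : ncseries_shift _ _ = 0) ?ncseries_eval0 ?mulr0.
Qed.

Lemma ncseries_evalX f k : ev (f ^+ k) =1 cauchy_exp (ev f) k.
Proof.
elim: k => [|k IH] n /=; first exact: ncseries_eval1.
by rewrite exprS ncseries_evalM; apply: eq_bigr => i _; rewrite IH.
Qed.

Lemma ncseries_eval_var a n : ev (ncvar a) n = if n == 1%N then x a else 0.
Proof.
case: n => [|n] /=; first by rewrite scale0r.
rewrite (bigD1 a)//= big1 ?addr0 => [|b ba].
  rewrite (_ : ncseries_shift _ _ = 1 :> ncseries T R).
    by rewrite ncseries_eval1 eqSS; case: eqP; rewrite ?mulr1 ?mulr0.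
  by apply/funext => w; rewrite /ncseries_shift /ncvar eqseq_cons eqxx; case: w.
rewrite (_ : ncseries_shift _ _ = 0) ?ncseries_eval0 ?mulr0//.
by apply/funext => w; rewrite /ncseries_shift /ncvar eqseq_cons (negPf ba).
Qed.

Lemma ncseries_eval_exp f n :
  ev (ncexp f) n = \sum_(k < n.+1) k`!%:R^-1 *: cauchy_exp (ev f) k n.
Proof.
under [RHS]eq_bigr do rewrite -ncseries_evalX -ncseries_evalZ.
rewrite -ncseries_eval_sum; apply: eq_ncseries_eval => w wn.
by rewrite /ncexp wn big_mkord ncseries_sumE.
Qed.

Lemma ncseries_eval_exp_var a n :
  ev (ncexp (ncvar a)) n = n`!%:R^-1 *: x a ^+ n.
Proof.
have evX k m : ev (ncvar a ^+ k) m = if m == k then x a ^+ k else 0.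
  elim: k m => [|k IH] m; first by rewrite expr0 ncseries_eval1; case: eqP.
  rewrite exprS ncseries_evalM /cauchy_prod; case: m => [|m].
    by rewrite big_ord_recl big_ord0 ncseries_eval_var mul0r addr0.
  rewrite !big_ord_recl ncseries_eval_var mul0r add0r big1 ?addr0.
    rewrite ncseries_eval_var IH /= subSS subn0 eqSS.
    by case: eqP; rewrite ?mulr0// exprS.
  by move=> i _; rewrite ncseries_eval_var mul0r.
rewrite ncseries_eval_exp big_ord_recr /= -ncseries_evalX evX eqxx.
rewrite big1 ?add0r// => i _; rewrite -ncseries_evalX evX.
by rewrite gtn_eqF// scaler0.
Qed.

End Evaluation.

(** * Lie monomials at traceless 2x2 matrices *)

Section LieMonomials.
Variables (T : finType) (R : realType).

(** The norm N is kept squared, so that its bounds are polynomial in the entries. *)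
Definition sqnorm (A : 'M[R]_2) : R := 2 * \sum_i \sum_j A i j ^+ 2.

Lemma mx2_mulE (A B : 'M[R]_2) i j :
  (A * B) i j = A i 0 * B 0 j + A i 1 * B 1 j.
Proof.
rewrite mxE !big_ord_recl big_ord0 addr0.
by congr (_ + A i _ * B _ j); apply/val_inj.
Qed.

Lemma sum_mx2E (F : 'I_2 -> R) : \sum_i F i = F 0 + F 1.
Proof. by rewrite !big_ord_recl big_ord0 addr0; congr (_ + F _); apply/val_inj. Qed.

(* In the matrix entries this is the Lagrange identity for the cross product
   of R^3, up to the signs which distinguish sl_2(R) from so(3). *)
Lemma sqnorm_comm (A B : 'M[R]_2) : \tr A = 0 -> \tr B = 0 ->
  sqnorm (A * B - B * A) <= sqnorm A * sqnorm B.
Proof.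
rewrite /mxtrace !sum_mx2E => A0 B0.
have {}A0 : A 1 1 = - A 0 0 by lra.
have {}B0 : B 1 1 = - B 0 0 by lra.
rewrite /sqnorm !sum_mx2E !mxE !sum_mx2E A0 B0 -subr_ge0.
set a := A 0 0; set b := A 0 1; set c := A 1 0.
set p := B 0 0; set q := B 0 1; set r := B 1 0.
rewrite [leRHS](_ : _ = 4 * (2 * a * p + b * q + c * r) ^+ 2); last ring.
by rewrite mulr_ge0// sqr_ge0.
Qed.

(** Induction on the monomial: homogeneity leaves a single degree [d], and the zero trace is carried
    along because [sqnorm_comm] requires it. As [s] bounds squared norms, it will be v^2. *)
Lemma lie_monomial_eval (x : T -> 'M[R]_2) (s : R) (P : ncseries T R) :
  0 <= s -> (forall a, \tr (x a) = 0 /\ sqnorm (x a) <= s) ->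
  lie_monomial P ->
  exists d, [/\ forall n, n != d -> ncseries_eval x P n = 0,
    \tr (ncseries_eval x P d) = 0 & sqnorm (ncseries_eval x P d) <= s ^+ d].
Proof.
move=> s0 xP; elim=> {P} [a|P Q _ [d [Pd trP nP]] _ [e [Qe trQ nQ]]].
  have [xa1 xa2] := xP a.
  by exists 1%N; split=> [n n1||]; rewrite ncseries_eval_var ?(negPf n1).
have evM (f g : ncseries T R) k l n :
    (forall i, i != k -> ncseries_eval x f i = 0) ->
    (forall i, i != l -> ncseries_eval x g i = 0) ->
    ncseries_eval x (f * g) n =
    if n == (k + l)%N then ncseries_eval x f k * ncseries_eval x g l else 0.
  move=> fk gl; rewrite ncseries_evalM /cauchy_prod.
  have [kn|nk] := leqP k n; last first.
    rewrite ltn_eqF ?(leq_trans nk (leq_addr _ _))// big1// => i _.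
    by rewrite fk ?mul0r// ltn_eqF// (leq_ltn_trans _ nk)// -ltnS.
  rewrite (bigD1 (Ordinal (kn : (k < n.+1)%N)))//= big1 ?addr0.
    case: eqP => [->|nkl]; first by rewrite addKn.
    by rewrite gl ?mulr0//; apply/eqP => nkl'; apply: nkl; rewrite -nkl' subnKC.
  by move=> i ik; rewrite fk ?mul0r.
exists (d + e)%N; split=> [n nde||]; rewrite /lie_bracket ncseries_evalB.
- by rewrite (evM _ _ d e)// (evM _ _ e d)// [(e + d)%N]addnC (negPf nde) subrr.
- rewrite (evM _ _ d e)// (evM _ _ e d)// [(e + d)%N]addnC eqxx linearB /=.
  by rewrite mxtrace_mulC subrr.
- rewrite (evM _ _ d e)// (evM _ _ e d)// [(e + d)%N]addnC eqxx exprD.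
  apply: (le_trans (sqnorm_comm trP trQ)); apply: ler_pM => //.
  all: rewrite mulr_ge0// sumr_ge0// => i _.
  all: by rewrite sumr_ge0// => j _; rewrite sqr_ge0.
Qed.

End LieMonomials.

(** * Cauchy products and exponentials of absolutely convergent series *)

Section Tannery.
Variable R : realType.
Implicit Types (f g m : R^nat).

(** Dominated convergence for sums whose number of terms grows with N. Cut at an index K after which
    [m] has a small tail: the head converges termwise, and the rest is at most twice the tail of
    [m]. *)
Lemma tannery (a : nat -> R^nat) (b m : R^nat) :
  (forall N i, `|a N i| <= m i) ->
  (forall i, a N i @[N --> \oo] --> b i) ->
  cvgn (series m) ->
  \sum_(0 <= i < N) a N i - series b N @[N --> \oo] --> (0 : R).
Proof.
move=> am ab cm.
have m0 i : 0 <= m i by apply: le_trans (am 0%N i); exact: normr_ge0.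
have bm i : `|b i| <= m i.
  have cb : `|a N i| @[N --> \oo] --> `|b i| by apply: cvg_norm; exact: ab.
  rewrite -(cvg_lim _ cb)//; apply: limr_le; first exact: cvgP cb.
  by apply: nearW => N.
have m_nd : nondecreasing_seq (series m) by apply: nondecreasing_series.
have m_le := nondecreasing_cvgn_le m_nd cm.
apply/cvgrPdist_le => e e0.
have e4 : 0 < e / 4 by rewrite divr_gt0.
have /cvgrPdist_le/(_ _ e4)[K _ /(_ K (leqnn K)) /= mK] := cm.
have finite_part : \sum_(0 <= i < K) (a N i - b i) @[N --> \oo] --> (0 : R).
  rewrite [X in _ --> X](_ : _ = \sum_(0 <= i < K) (b i - b i)); last first.
    by rewrite big1// => i _; rewrite subrr.
  apply: cvg_big => [|i _]; first exact: add_continuous.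
  by apply: cvgB; [exact: ab|exact: cvg_cst].
have e2 : 0 < e / 2 by rewrite divr_gt0.
near=> N.
have KN : (K <= N)%N by near: N; exact: nbhs_infty_ge.
rewrite sub0r normrN /series /= -sumrB (big_cat_nat (leq0n K) KN)//=.
have -> : e = e / 2 + (e / 4 + e / 4) by lra.
apply: le_trans (ler_normD _ _) _; apply: lerD.
  rewrite -normrN -sub0r; near: N; move/cvgrPdist_le : finite_part; exact.
apply: le_trans (ler_norm_sum _ _ _) _.
apply: (@le_trans _ _ (\sum_(K <= i < N) (m i + m i))).
  by apply: ler_sum => i _; apply: le_trans (ler_normB _ _) _; apply: lerD.
rewrite big_split /=.
have : \sum_(K <= i < N) m i <= e / 4.
  rewrite (_ : \sum_(K <= i < N) m i = series m N - series m K); last first.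
    by rewrite /series /= (big_cat_nat (leq0n K) KN)//= addrAC subrr add0r.
  apply: le_trans mK; apply: le_trans (ler_norm _).
  by rewrite lerD2r m_le.
by move=> h; apply: lerD.
Unshelve. all: by end_near. Qed.

Lemma cvg_sum_le (m : R^nat) (c : R) :
  (forall i, 0 <= m i) -> (forall N, \sum_(0 <= i < N) m i <= c) ->
  cvgn (series m).
Proof.
move=> m0 mc; apply: nondecreasing_is_cvgn; first exact: nondecreasing_series.
by exists c => _ [N _ <-]; exact: mc.
Qed.

(** The bound [c] is explicit because the powers of a series need geometric bounds, to be dominated
    by an exponential series. *)
Definition abs_summable (f : R^nat) (s c : R) :=
  series f @ \oo --> s /\ forall N, \sum_(0 <= i < N) `|f i| <= c.

Lemma abs_summableD f g s t c d :
  abs_summable f s c -> abs_summable g t d ->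
  abs_summable (fun n => f n + g n) (s + t) (c + d).
Proof.
move=> [fs fc] [gt gd]; split.
  rewrite (_ : series _ = series f + series g); first exact: cvgD.
  by apply/funext => N; rewrite /series /= big_split.
move=> N; apply: le_trans (lerD (fc N) (gd N)); rewrite -big_split.
by apply: ler_sum => i _; exact: ler_normD.
Qed.

(** The triangle i + j < N is summed along antidiagonals on the left and along rows on the right. *)
Lemma sum_cauchy (K : comNzRingType) (f g : nat -> K) N :
  \sum_(0 <= n < N) \sum_(i < n.+1) f i * g (n - i)%N =
  \sum_(0 <= i < N) f i * \sum_(0 <= j < N - i) g j.
Proof.
elim: N => [|N IH]; first by rewrite !big_geq.
rewrite big_nat_recr//= IH [RHS]big_nat_recr//= subSnn big_nat1.
rewrite -(big_mkord xpredT (fun i => f i * g (N - i)%N)) big_nat_recr//=.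
rewrite subnn addrA; congr (_ + _).
rewrite -big_split /= big_nat [RHS]big_nat; apply: eq_bigr => i /andP[_ iN].
by rewrite (subSn (ltnW iN)) big_nat_recr//= mulrDr.
Qed.

(** [sum_cauchy] exhibits the partial sums of [g] as inner factors; they tend to [t] and are bounded
    by [d], so [tannery] passes to the limit. *)
Lemma abs_summable_cauchy f g s t c d :
  abs_summable f s c -> abs_summable g t d ->
  abs_summable (fun n => \sum_(i < n.+1) f i * g (n - i)%N) (s * t) (c * d).
Proof.
move=> [fs fc] [gt gd].
have d0 : 0 <= d by apply: le_trans (gd 0%N); rewrite big_geq.
have c0 : 0 <= c by apply: le_trans (fc 0%N); rewrite big_geq.
split; last first.
  move=> N; apply: (@le_trans _ _
    (\sum_(0 <= n < N) \sum_(i < n.+1) `|f i| * `|g (n - i)%N|)).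
    apply: ler_sum => n _; apply: le_trans (ler_norm_sum _ _ _) _.
    by apply: ler_sum => i _; rewrite normrM.
  rewrite (sum_cauchy (fun i : nat => `|f i| : R) (fun i : nat => `|g i| : R)).
  apply: (@le_trans _ _ (\sum_(0 <= i < N) `|f i| * d)).
    by apply: ler_sum => i _; rewrite ler_wpM2l.
  by rewrite -mulr_suml ler_wpM2r.
have main := @tannery (fun N i => f i * series g (N - i)%N) (fun i => f i * t)
   (fun i => `|f i| * d).
have -> : series (fun n => \sum_(i < n.+1) f i * g (n - i)%N) =
    (fun N => \sum_(0 <= i < N) f i * series g (N - i)%N -
      series (fun i => f i * t) N) + (fun N => series (fun i => f i * t) N).
  apply/funext => N /=; rewrite [RHS]addrC subrKC /series /=.
  exact: sum_cauchy.
rewrite -[s * t]add0r; apply: cvgD; last first.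
  rewrite (_ : (fun N => _) = (fun N => series f N * t)).
    by apply: cvgM => //; exact: cvg_cst.
  by apply/funext => N; rewrite /series /= mulr_suml.
apply: main => [N i|i|].
- rewrite normrM ler_wpM2l// (le_trans (ler_norm_sum _ _ _))//.
- apply: cvgM; first exact: cvg_cst.
  by rewrite -(cvg_centern i) in gt.
- apply: (@cvg_sum_le _ (c * d)) => [i|N]; first by rewrite mulr_ge0.
  by rewrite -mulr_suml ler_wpM2r.
Qed.

End Tannery.

(** * Entrywise absolutely convergent matrix series *)

Section MatrixSeries.
Variable R : realType.
Implicit Types (a b : nat -> 'M[R]_2) (S : 'M[R]_2).

Definition mx_abs_summable a S (c : R) :=
  forall i j, abs_summable (fun n => a n i j) (S i j) c.

(** The factor 2 counts the two terms in an entry of a 2x2 product. *)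
Lemma mx_abs_summable_cauchy a b S S' c d :
  mx_abs_summable a S c -> mx_abs_summable b S' d ->
  mx_abs_summable (cauchy_prod a b) (S * S') (2 * c * d).
Proof.
move=> aS bS' i j; rewrite mx2_mulE.
rewrite (_ : (fun n => _) = fun n =>
    \sum_(k < n.+1) a k i 0 * b (n - k)%N 0 j +
    \sum_(k < n.+1) a k i 1 * b (n - k)%N 1 j).
  rewrite -mulrA mulr2n mulrDl mul1r.
  exact: abs_summableD (abs_summable_cauchy (aS i 0) (bS' 0 j))
    (abs_summable_cauchy (aS i 1) (bS' 1 j)).
apply/funext => n; rewrite /cauchy_prod summxE -big_split.
by apply: eq_bigr => k _; rewrite mx2_mulE.
Qed.

Lemma mx_abs_summable1 : mx_abs_summable (fun n => (n == 0%N)%:R) 1 1.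
Proof.
move=> i j; split.
  rewrite -cvg_shiftS /=.
  rewrite (_ : (fun n => _) = fun=> (1 : 'M[R]_2) i j); first exact: cvg_cst.
  apply/funext => n; rewrite /series /= big_nat_recl//= big1 ?addr0// => k _.
  by rewrite mxE.
case=> [|N]; first by rewrite big_geq.
rewrite big_nat_recl//= big1 ?addr0 => [|k _].
  by rewrite mxE; case: eqP; rewrite ?normr1 ?normr0.
by rewrite mxE normr0.
Qed.

Lemma mx_abs_summable_exp a S c k :
  mx_abs_summable a S c ->
  mx_abs_summable (cauchy_exp a k) (S ^+ k) ((2 * c) ^+ k).
Proof.
move=> aS; elim: k => [|k IH] /=; first by rewrite !expr0; exact: mx_abs_summable1.
by rewrite !exprS; exact: mx_abs_summable_cauchy.
Qed.

Lemma cauchy_exp_small a k n : a 0%N = 0 -> (n < k)%N -> cauchy_exp a k n = 0.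
Proof.
move=> a0; elim: k n => // k IH n nk /=; rewrite /cauchy_prod big1// => i _.
case: (posnP i) => [->|i0]; first by rewrite a0 mul0r.
rewrite IH ?mulr0// ltn_subLR; last by rewrite -ltnS.
by rewrite (leq_trans nk)// -[k.+1]add1n leq_add2r.
Qed.

(** Since [a] starts in degree 1, the terms with k > n vanish and the triangular sum completes to a
    square. Exchanging the sums leaves partial sums of the k-th Cauchy power of [a], divided by k!
    and dominated by (2 c)^k / k!, to which [tannery] applies. *)
Lemma cvg_exp_cauchy a S c i j : mx_abs_summable a S c -> a 0%N = 0 ->
  \sum_(0 <= n < N) (\sum_(k < n.+1) k`!%:R^-1 *: cauchy_exp a k n) i j -
  \sum_(0 <= k < N) k`!%:R^-1 * (S ^+ k) i j @[N --> \oo] --> (0 : R).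
Proof.
move=> aS a0.
have aSk k := mx_abs_summable_exp k aS i j.
have c0 : 0 <= c by apply: le_trans ((aS i j).2 0%N); rewrite big_geq.
rewrite (_ : (fun N => _) = fun N => \sum_(0 <= k < N)
    (k`!%:R^-1 * series (fun n => cauchy_exp a k n i j) N) -
    series (fun k => k`!%:R^-1 * (S ^+ k) i j) N); last first.
  apply/funext => N; congr (_ - _); under [RHS]eq_bigr do rewrite mulr_sumr.
  rewrite exchange_big /=.
  rewrite big_nat [RHS]big_nat; apply: eq_bigr => n /andP[_ nN].
  rewrite summxE [RHS](big_cat_nat (n := n.+1))//= big_mkord.
  rewrite [X in _ = _ + X]big_nat [X in _ = _ + X]big1 => [|k /andP[nk _]].
    by rewrite addr0; apply: eq_bigr => k _; rewrite mxE.
  by rewrite cauchy_exp_small// mxE mulr0.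
apply: (@tannery _ _ _ (exp_coeff (2 * c))) => [N k|k|].
- rewrite normrM ger0_norm ?invr_ge0// /exp_coeff /= mulrC ler_wpM2r ?invr_ge0//.
  by apply: le_trans (ler_norm_sum _ _ _) _; exact: (aSk k).2.
- by apply: cvgM; [exact: cvg_cst|exact: (aSk k).1].
- exact: is_cvg_series_exp_coeff.
Qed.

End MatrixSeries.

(** * Exponentials in sl_2(R) *)

Section MatrixExponential.
Variable R : realType.
Implicit Types X L E : 'M[R]_2.

Lemma exprn_square_scalar X q n : X * X = q *: 1 ->
  X ^+ n = q ^+ n./2 *: (if odd n then X else 1).
Proof.
move=> XX; elim: n => [|n IH]; first by rewrite !expr0 scale1r.
rewrite exprS IH -scalerAr /= uphalf_half; case: (odd n) => /=.
  by rewrite XX scalerA add1n exprSr.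
by rewrite mulr1 add0n.
Qed.

Lemma exp_term_square_scalar X s n : s != 0 -> X * X = - s ^+ 2 *: 1 ->
  n`!%:R^-1 *: X ^+ n = cos_coeff s n *: 1 + (sin_coeff s n / s) *: X.
Proof.
move=> s0 /exprn_square_scalar ->; rewrite /cos_coeff /sin_coeff /= -exprnP.
have nE := odd_double_half n.
case: (boolP (odd n)) nE => on /= nE.
  rewrite !mul0r scale0r add0r !mul1r scalerA; congr (_ *: _).
  have -> : s ^+ n = s * (s ^+ 2) ^+ n./2.
    by rewrite -{1}nE add1n exprS -mul2n exprM.
  have -> : n.-1./2 = n./2 by rewrite -{1}nE add1n /= doubleK.
  rewrite [(- s ^+ 2) ^+ _]exprNn.
  move: ((-1) ^+ _) ((s ^+ 2) ^+ _) (_%:R^-1) => x y z.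
  by field.
rewrite !mul0r scale0r addr0 !mul1r scalerA; congr (_ *: _).
have -> : s ^+ n = (s ^+ 2) ^+ n./2 by rewrite -{1}nE add0n -mul2n exprM.
by rewrite [(- s ^+ 2) ^+ _]exprNn mulrC.
Qed.

Lemma abs_summableZ (f : R^nat) t c k :
  abs_summable f t c -> abs_summable (fun n => k * f n) (k * t) (`|k| * c).
Proof.
move=> [ft fc]; split.
  rewrite (_ : series _ = (fun N => k * series f N)).
    by apply: cvgM => //; exact: cvg_cst.
  by apply/funext => N; rewrite /series /= mulr_sumr.
move=> N; under eq_bigr do rewrite normrM.
by rewrite -mulr_sumr ler_wpM2l.
Qed.

Lemma abs_summable_dominated (f : R^nat) t (m : R^nat) :
  (forall n, `|f n| <= m n) -> cvgn (series m) -> series f @ \oo --> t ->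
  abs_summable f t (limn (series m)).
Proof.
move=> fm cm ft; split=> // N.
apply: (@le_trans _ _ (series m N)); first exact: ler_sum.
apply: nondecreasing_cvgn_le => //; apply: nondecreasing_series => i _ _.
exact: le_trans (fm i).
Qed.

(** Splitting by parity gives exp X = cos s + (sin s / s) X; both scalar series are dominated by
    that of exp |s|. *)
Lemma mx_abs_summable_exp_square_scalar X s : s != 0 ->
  X * X = - s ^+ 2 *: 1 ->
  exists c, mx_abs_summable (fun n => n`!%:R^-1 *: X ^+ n)
    (cos s *: 1 + (sin s / s) *: X) c.
Proof.
move=> s0 XX; pose e := limn (series (exp_coeff `|s|)).
have ce := is_cvg_series_exp_coeff `|s|.
have cosS : abs_summable (cos_coeff s) (cos s) e.
  apply: abs_summable_dominated => // [n|].
    rewrite /cos_coeff /exp_coeff /= !normrM normfV normr_nat -exprnP normrX.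
    rewrite normrN normr1 expr1n mulr1 normr_nat normrX.
    by case: odd; rewrite ?mul1r ?mul0r// divr_ge0.
  by rewrite cos.unlock; exact: is_cvg_series_cos_coeff.
have sinS : abs_summable (sin_coeff s) (sin s) e.
  apply: abs_summable_dominated => // [n|].
    rewrite /sin_coeff /exp_coeff /= !normrM normfV normr_nat normrX.
    rewrite normrN normr1 expr1n mulr1 normr_nat normrX.
    by case: odd; rewrite ?mul1r ?mul0r// divr_ge0.
  by rewrite sin.unlock; exact: is_cvg_series_sin_coeff.
have e0 : 0 <= e by apply: le_trans (cosS.2 0%N); rewrite big_geq.
pose B i j := `|(1 : 'M[R]_2) i j| * e + `|X i j / s| * e.
have B0 i j : 0 <= B i j by rewrite addr_ge0// mulr_ge0.
(* One constant has to serve every entry, hence the sum of the entrywise bounds. *)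
exists (\sum_i \sum_j B i j) => i j.
have [cvgE boundE] := abs_summableD (abs_summableZ ((1 : 'M[R]_2) i j) cosS)
  (abs_summableZ (X i j / s) sinS).
have -> : (fun n => (n`!%:R^-1 *: X ^+ n) i j) =
    fun n => (1 : 'M[R]_2) i j * cos_coeff s n + X i j / s * sin_coeff s n.
  apply/funext => n; rewrite (exp_term_square_scalar _ s0 XX) mxE [X in X + _]mxE.
  by rewrite [X in _ + X]mxE mulrC; congr (_ + _); rewrite [LHS]mulrC mulrCA mulrC.
have -> : (cos s *: 1 + (sin s / s) *: X) i j =
    (1 : 'M[R]_2) i j * cos s + X i j / s * sin s.
  rewrite mxE [X in X + _]mxE.
  by rewrite [X in _ + X]mxE mulrC; congr (_ + _); rewrite [LHS]mulrC mulrCA mulrC.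
split; first exact: cvgE.
move=> N; apply: le_trans (boundE N) _.
rewrite -/(B i j) (bigD1 i)//= (bigD1 j)//= -addrA lerDl addr_ge0//.
  by apply: sumr_ge0.
by apply: sumr_ge0 => k _; apply: sumr_ge0.
Qed.

Lemma mx2_detE L : \det L = L 0 0 * L 1 1 - L 0 1 * L 1 0.
Proof.
rewrite (expand_det_row _ 0) sum_mx2E /cofactor !det_mx11 !mxE /=.
have -> : lift (0 : 'I_2) (0 : 'I_1) = 1 by apply/val_inj.
have -> : lift (1 : 'I_2) (0 : 'I_1) = 0 by apply/val_inj.
by rewrite expr0 expr1 mul1r mulN1r mulrN.
Qed.

(** Cayley-Hamilton for trace zero. *)
Lemma traceless_square L : \tr L = 0 -> L * L = - \det L *: 1.
Proof.
rewrite /mxtrace sum_mx2E => L0.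
have {}L0 : L 1 1 = - L 0 0 by lra.
apply/matrixP => i j; rewrite mx2_mulE !mxE mx2_detE.
have oE (k : 'I_2) : k = 0 \/ k = 1.
  by case: k => [[|[|k]] kl]//; [left|right]; apply/val_inj.
by case: (oE i) => ->; case: (oE j) => -> /=; rewrite ?L0; ring.
Qed.

(* The one-parameter subgroups of SL_2(R) miss the parabolic elements of
   trace -2. *)
Lemma exp_traceless_trace_eqN2 L E : \tr L = 0 ->
  (forall i j, \sum_(0 <= k < N) k`!%:R^-1 * (L ^+ k) i j @[N --> \oo] --> E i j) ->
  \tr E = - 2 -> E = - 1.
Proof.
move=> L0 expL trE; have LL := traceless_square L0.
have [d0|d0] := ltP 0 (\det L).
  (* Elliptic case: exp L = cos s + (sin s / s) L, so the trace forces cos s = -1 and hence sin s =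
     0. *)
  pose s := Num.sqrt (\det L).
  have s0 : s != 0 by rewrite sqrtr_eq0 -ltNge.
  have [c cS] : exists c, mx_abs_summable (fun n => n`!%:R^-1 *: L ^+ n)
      (cos s *: 1 + (sin s / s) *: L) c.
    by apply: mx_abs_summable_exp_square_scalar; rewrite // sqr_sqrtr ?ltW.
  have EE : E = cos s *: 1 + (sin s / s) *: L.
    apply/matrixP => i j; have := (cS i j).1; have := expL i j.
    rewrite (_ : (fun N => _) = series (fun n => (n`!%:R^-1 *: L ^+ n) i j)).
      by move=> /cvg_lim <-// /cvg_lim <-.
    by apply/funext => N; apply: eq_bigr => k _; rewrite mxE.
  have cN1 : cos s = - 1.
    by move: trE; rewrite EE mxtraceD !mxtraceZ L0 mulr0 mxtrace1 addr0; lra.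
  have sin0 : sin s = 0.
    by apply/eqP; rewrite -norm_cos_eq1 cN1 normrN1.
  by rewrite EE cN1 sin0 mul0r scale0r addr0 scaleN1r.
(* Here L^2 is a nonnegative scalar: even powers have nonnegative trace, odd ones trace zero, and
   the term k = 0 already contributes 2. *)
have : 2 <= \tr E.
  have ctr : \sum_(0 <= k < N) k`!%:R^-1 * \tr (L ^+ k) @[N --> \oo] --> \tr E.
    rewrite /mxtrace sum_mx2E.
    rewrite (_ : (fun N => _) = (fun N => \sum_(0 <= k < N) k`!%:R^-1 * (L ^+ k) 0 0)
       + (fun N => \sum_(0 <= k < N) k`!%:R^-1 * (L ^+ k) 1 1)); first exact: cvgD.
    apply/funext => N; under eq_bigr do rewrite sum_mx2E mulrDr.
    by rewrite big_split.
  rewrite -(cvg_lim _ ctr)//; apply: limr_ge; first exact: cvgP ctr.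
  near=> N.
  have N0 : (0 < N)%N by near: N; exact: nbhs_infty_gt.
  rewrite -(prednK N0) big_nat_recl//= expr0 mxtrace1 fact0 invr1 mul1r lerDl.
  apply: sumr_ge0 => k _; rewrite mulr_ge0 ?invr_ge0//.
  rewrite (exprn_square_scalar _ LL) mxtraceZ mulr_ge0//.
    by rewrite exprn_ge0// oppr_ge0.
  by case: odd; rewrite ?L0// mxtrace1.
by rewrite trE => h; exfalso; lra.
Unshelve. all: by end_near. Qed.

End MatrixExponential.

(** * Convergence and divergence of the BCH series *)

Section LieNormEval.
Variables (T : finType) (R : realType) (x : T -> 'M[R]_2) (v : R).
Hypotheses (v0 : 0 < v)
  (xv : forall a, \tr (x a) = 0 /\ sqnorm (x a) <= v ^+ 2).
Implicit Types P : ncseries T R.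

Lemma lie_l1norm_ge0 P : (0 <= lie_l1norm P)%E.
Proof.
apply: le_ereal_inf_tmp => _ [n [theta [M [_ _ ->]]]].
by rewrite lee_fin sumr_ge0.
Qed.

Lemma sqnorm_entry (A : 'M[R]_2) i j c :
  0 <= c -> sqnorm A <= c ^+ 2 -> `|A i j| <= c.
Proof.
move=> c0 Ac; rewrite -ler_sqr ?nnegrE// real_normK ?num_real//.
apply: le_trans Ac; rewrite /sqnorm (bigD1 i)//= (bigD1 j)//=.
set r1 := \sum_(_ | _) _; set r2 := \sum_(_ | _) _.
have : 0 <= r1 by apply: sumr_ge0 => k _; exact: sqr_ge0.
have : 0 <= r2.
  by apply: sumr_ge0 => k _; apply: sumr_ge0 => l _; exact: sqr_ge0.
have := sqr_ge0 (A i j); lra.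
Qed.

Lemma lie_monomial_entry P n i j :
  lie_monomial P -> `|ncseries_eval x P n i j| <= v ^+ n.
Proof.
move=> /(lie_monomial_eval (sqr_ge0 v) xv)[d [Pd _ nP]].
have [->|nd] := eqVneq n d; last by rewrite Pd// mxE normr0 exprn_ge0// ltW.
apply: sqnorm_entry; first by rewrite exprn_ge0// ltW.
by rewrite -exprM mulnC exprM.
Qed.

(** A finite norm is an infimum over a nonempty set, so [P] is a combination of Lie monomials. *)
Lemma lie_l1norm_trace P n : lie_l1norm P != +oo%E ->
  \tr (ncseries_eval x P n) = 0.
Proof.
rewrite -ltey => /ereal_inf_lt[_ [k [theta [M [lieM -> _]]]] _].
rewrite ncseries_eval_sum raddf_sum big1// => l _ /=.
rewrite ncseries_evalZ mxtraceZ.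
have [d [Md trM _]] := lie_monomial_eval (sqr_ge0 v) xv (lieM l).
have [->|nd] := eqVneq n d; first by rewrite trM mulr0.
by rewrite Md// mxtrace0 mulr0.
Qed.

Lemma lie_l1norm_entry P n i j :
  (`|ncseries_eval x P n i j|%:E <= lie_l1norm P * (v ^+ n)%:E)%E.
Proof.
have vn : 0 < v ^+ n by rewrite exprn_gt0.
(* Divided by [v ^+ n], the claim is a lower bound of the set whose infimum is the norm; an infinite
   norm needs no separate case. *)
rewrite -lee_pdivrMr//; apply: le_ereal_inf_tmp.
move=> _ [k [theta [M [lieM -> ->]]]].
rewrite lee_pdivrMr// lee_fin ncseries_eval_sum summxE mulr_suml.
apply: le_trans (ler_norm_sum _ _ _) _; apply: ler_sum => l _.
rewrite ncseries_evalZ mxE normrM ler_wpM2l//.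
exact: lie_monomial_entry.
Qed.

End LieNormEval.

Section BCHEval.
Variables (R : realType) (x : 'I_2 -> 'M[R]_2) (v : R).
Hypotheses (v0 : 0 < v)
  (xv : forall a, \tr (x a) = 0 /\ sqnorm (x a) <= v ^+ 2).

Let B n := ncseries_eval x (@BCH R) n.

Lemma BCH_eval_comp n :
  B n = \sum_(i < n.+1) ncseries_eval x (BCH_comp i (n - i)) n.
Proof.
rewrite -ncseries_eval_sum; apply: eq_ncseries_eval => w wn.
have cw : (count_mem (ord0 : 'I_2) w + count_mem (ord_max : 'I_2) w)%N = n.
  rewrite -wn -(count_predC (pred1 (ord0 : 'I_2)) w); congr (_ + _)%N.
  by apply: eq_count => -[[|[|k]] kl].
have c0n : (count_mem (ord0 : 'I_2) w < n.+1)%N by rewrite ltnS -cw leq_addr.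
rewrite ncseries_sumE (bigD1 (Ordinal c0n))//= big1 ?addr0 => [|i ine].
  by rewrite /BCH_comp eqxx -cw addKn eqxx.
rewrite /BCH_comp; case: eqP => //= e; move: ine.
by rewrite -(inj_eq val_inj) /= e eqxx.
Qed.

Lemma BCH_eval0 : B 0%N = 0.
Proof. by rewrite /B /= /BCH /nclog big_geq// scale0r. Qed.

Let t (p : nat * nat) : \bar R :=
  (lie_l1norm (@BCH_comp R p.1 p.2) * (v ^+ p.1 * v ^+ p.2)%:E)%E.

Hypothesis Gamma_fin : GammaLie v v != +oo%E.

Let sum_le_Gamma (r : seq (nat * nat)) :
  uniq r -> {in r, forall p, (1 <= p.1 + p.2)%N} ->
  (\sum_(p <- r) t p <= GammaLie v v)%E.
Proof.
move=> ur rp; apply: esum_ge; exists [set` r]; last by rewrite fsbig_seq.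
by split; [exact: finite_seq | exact: rp].
Qed.

Lemma BCH_comp_norm_fin n1 n2 :
  (1 <= n1 + n2)%N -> lie_l1norm (@BCH_comp R n1 n2) != +oo%E.
Proof.
move=> n12; apply/eqP => noo; move/eqP: Gamma_fin; apply.
apply/eqP; rewrite -leye_eq.
have : (t (n1, n2) <= GammaLie v v)%E.
  have := @sum_le_Gamma [:: (n1, n2)]; rewrite big_seq1; apply => // p.
  by rewrite inE => /eqP ->.
by rewrite /t /= noo gt0_mulye// lte_fin mulr_gt0// exprn_gt0.
Qed.

(* No appeal to the theorem that BCH is a Lie series: otherwise some component
   would have infinite norm. *)
Lemma BCH_eval_trace n : \tr (B n) = 0.
Proof.
case: n => [|n]; first by rewrite BCH_eval0 mxtrace0.
rewrite BCH_eval_comp raddf_sum big1// => i _.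
apply: (lie_l1norm_trace xv); apply: BCH_comp_norm_fin.
by rewrite subnKC// -ltnS.
Qed.

(** Grouping the bidegrees by total degree n, each component costs at most its norm times v^n, so
    the left side is below a finite sum of distinct terms of [GammaLie v v]. *)
Lemma BCH_eval_summable i j N :
  \sum_(0 <= n < N) `|B n i j| <= fine (GammaLie v v).
Proof.
have G0 : (0 <= GammaLie v v)%E.
  by have := @sum_le_Gamma [::]; rewrite big_nil; exact.
have Gf : GammaLie v v \is a fin_num by rewrite ge0_fin_numE// ltey.
rewrite -lee_fin fineK// -sumEFin.
(* Total degree 0 is left out, as in [GammaLie]; it contributes nothing by [BCH_eval0]. *)
pose r := [seq (k, (n - k)%N) | n <- index_iota 1 N, k <- index_iota 0 n.+1].
apply: (@le_trans _ _ (\sum_(p <- r) t p)%E); last first.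
  apply: sum_le_Gamma => [|p].
    apply: allpairs_uniq_dep => [|n _|]; [exact: iota_uniq..|].
    move=> _ _ /allpairsPdep[n [k [_ + ->]]] /allpairsPdep[n' [k' [_ + ->]]] /=.
    rewrite !mem_index_iota => kn kn' [kk' nn'].
    by have -> : n = n'; [lia|rewrite kk'].
  case/allpairsPdep => n [k [+ + ->]] /=; rewrite !mem_index_iota.
  by move=> /andP[n1 _]; rewrite ltnS /= => kn; rewrite subnKC.
rewrite big_allpairs_dep /=.
apply: (@le_trans _ _ (\sum_(1 <= n < N) `|B n i j|%:E)%E).
  case: N {r} => [|N]; first by rewrite !big_geq.
  by rewrite big_ltn// BCH_eval0 mxE normr0 add0e.
rewrite big_seq [leRHS]big_seq; apply: lee_sum => n.
rewrite mem_index_iota => /andP[n1 _].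
rewrite BCH_eval_comp summxE big_mkord.
apply: (@le_trans _ _ (\sum_(k < n.+1)
    `|ncseries_eval x (BCH_comp k (n - k)) n i j|%:E)%E).
  by rewrite sumEFin lee_fin ler_norm_sum.
apply: lee_sum => k _; rewrite /t /= -exprD subnKC; last by rewrite -ltnS.
exact: lie_l1norm_entry.
Qed.

End BCHEval.

(** * Divergence, from explicit matrices *)

Section Divergence.
Variable R : realType.

(** This is [ncexp_nclog] for exp Y1 exp Y2, evaluated in degree [n]. *)
Lemma exp_BCH_eval (x : 'I_2 -> 'M[R]_2) n :
  \sum_(k < n.+1) k`!%:R^-1 *: cauchy_exp (ncseries_eval x (@BCH R)) k n =
  cauchy_prod (fun m => m`!%:R^-1 *: x ord0 ^+ m)
    (fun m => m`!%:R^-1 *: x ord_max ^+ m) n.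
Proof.
rewrite -ncseries_eval_exp ncexp_nclog; last first.
  rewrite ncseriesME big_ord_recl big_ord0 addr0 /ncexp !big_nat1 !expr0.
  by rewrite fact0 invr1 !mul1r.
rewrite ncseries_evalM; apply: eq_bigr => i _.
by rewrite !ncseries_eval_exp_var.
Qed.

Lemma GammaLie_pinfty_of_exp (x : 'I_2 -> 'M[R]_2) (v s : R) :
  0 < v -> s != 0 ->
  (forall a, \tr (x a) = 0 /\ sqnorm (x a) <= v ^+ 2) ->
  (forall a, x a * x a = - s ^+ 2 *: 1) ->
  let E := (cos s *: 1 + (sin s / s) *: x ord0) *
           (cos s *: 1 + (sin s / s) *: x ord_max) in
  \tr E = - 2 -> E != - 1 -> GammaLie v v = +oo%E.
Proof.
move=> v0 s0 xv xx E trE EN1; apply/eqP; apply: contraNT EN1 => Goo.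
pose B := ncseries_eval x (@BCH R).
pose C := fine (GammaLie v v).
have BC i j N : \sum_(0 <= n < N) `|B n i j| <= C.
  exact: BCH_eval_summable.
pose L : 'M[R]_2 := \matrix_(i, j) limn (series (fun n => B n i j)).
have BL : mx_abs_summable B L C.
  move=> i j; split; last exact: BC.
  rewrite mxE; apply: normed_cvg; exact: cvg_sum_le (BC i j).
have trL : \tr L = 0.
  rewrite /mxtrace sum_mx2E.
  have trB : series (fun n => B n 0 0) + series (fun n => B n 1 1) = fun=> 0.
    apply/funext => N.
    transitivity (\sum_(0 <= n < N) (B n 0 0 + B n 1 1)).
      by rewrite big_split.
    rewrite big1// => n _.
    by have := BCH_eval_trace v0 xv Goo n; rewrite /mxtrace sum_mx2E.
  have cvgL : series (fun n => B n 0 0) + series (fun n => B n 1 1) @ \oo -->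
    L 0 0 + L 1 1 by apply: cvgD; [exact: (BL 0 0).1|exact: (BL 1 1).1].
  by rewrite trB in cvgL; rewrite -(cvg_lim _ cvgL)// lim_cst.
have [c1 X1] := mx_abs_summable_exp_square_scalar s0 (xx ord0).
have [c2 X2] := mx_abs_summable_exp_square_scalar s0 (xx ord_max).
have XE := mx_abs_summable_cauchy X1 X2.
apply/eqP; apply: (exp_traceless_trace_eqN2 trL) trE => i j.
(* The partial sums of exp L and those of the homogeneous parts of exp X exp Y differ by a null
   sequence, and the latter tend to [E]. *)
have := cvg_exp_cauchy i j BL (BCH_eval0 x).
under eq_cvg do under eq_bigr do rewrite exp_BCH_eval.
move=> /(cvgB (XE i j).1); rewrite subr0; apply: cvg_trans.
apply: near_eq_cvg; apply: nearW => N /=.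
exact: subKr.
Qed.


Definition mx2 (a b c d : R) : 'M[R]_2 :=
  \matrix_(i, j) if i == 0 then if j == 0 then a else b
                 else if j == 0 then c else d.

Lemma GammaLie_pinfty (s : R) : 0 < s < pi / 2 ->
  let v := s / sin s * (2 * Num.sqrt (1 + cos s ^+ 2)) in
  GammaLie v v = +oo%E.
Proof.
move=> /andP[s0 sp] v.
have c0 : 0 < cos s.
  apply: cos_gt0_pihalf; rewrite sp andbT (lt_trans _ s0)// oppr_lt0.
  by rewrite divr_gt0// pi_gt0.
have S0 : 0 < sin s by apply: sin_gt0_pihalf; rewrite s0.
have cs := cos2Dsin2 s.
have q0 : 0 <= 1 + cos s ^+ 2 by rewrite addr_ge0// sqr_ge0.
have v0 : 0 < v.
  by rewrite mulr_gt0 ?divr_gt0// mulr_gt0// sqrtr_gt0 ltr_wpDr// sqr_ge0.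
have v2 : v ^+ 2 * sin s ^+ 2 = 4 * s ^+ 2 * (1 + cos s ^+ 2).
  rewrite -[in RHS](sqr_sqrtr q0) /v.
  by field; rewrite gt_eqF.
(* This keeps the radicand of [b] nonnegative. *)
have v4s : 4 * s ^+ 2 <= v ^+ 2.
  rewrite -(ler_pM2r (exprn_gt0 2 S0)) v2; apply: ler_wpM2l.
    by rewrite mulr_ge0// sqr_ge0.
  by have := sqr_ge0 (cos s); lra.
pose a := Num.sqrt ((v ^+ 2 + 4 * s ^+ 2) / 2).
pose b := Num.sqrt ((v ^+ 2 - 4 * s ^+ 2) / 2).
have a2 : a ^+ 2 = (v ^+ 2 + 4 * s ^+ 2) / 2.
  by rewrite sqr_sqrtr//; have := sqr_ge0 v; have := sqr_ge0 s; lra.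
have b2 : b ^+ 2 = (v ^+ 2 - 4 * s ^+ 2) / 2.
  by rewrite sqr_sqrtr// divr_ge0// subr_ge0 v4s.
have a0 : 0 < a.
  by rewrite sqrtr_gt0; have := exprn_gt0 2 v0; have := sqr_ge0 s; lra.
have b0 : 0 <= b by exact: sqrtr_ge0.
pose x (i : 'I_2) := if i == ord0 then mx2 (b / 2) (- a / 2) (a / 2) (- b / 2)
  else mx2 (- b / 2) (- a / 2) (a / 2) (b / 2).
have s_neq0 : s != 0 by rewrite gt_eqF.
pose k := sin s / s.
have k0 : 0 < k by rewrite divr_gt0.
have kv : k ^+ 2 * v ^+ 2 = 4 * (1 + cos s ^+ 2).
  by rewrite expr_div_n mulrAC [sin s ^+ 2 * _]mulrC v2; field.
have E01 (p q u w : R) : mx2 p q u w 0 1 = q by rewrite mxE.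
have E00 (p q u w : R) : mx2 p q u w 0 0 = p by rewrite mxE.
have E10 (p q u w : R) : mx2 p q u w 1 0 = u by rewrite mxE.
have E11 (p q u w : R) : mx2 p q u w 1 1 = w by rewrite mxE.
have mxZE (c : R) (A : 'M[R]_2) i j : (c *: A) i j = c * A i j by rewrite mxE.
have mxDE (A B : 'M[R]_2) i j : (A + B) i j = A i j + B i j by rewrite mxE.
have x0 : x ord0 = mx2 (b / 2) (- a / 2) (a / 2) (- b / 2) by [].
have x1 : x ord_max = mx2 (- b / 2) (- a / 2) (a / 2) (b / 2) by [].
have oE (i : 'I_2) : i = 0 \/ i = 1.
  by case: i => [[|[|i]] il]//; [left|right]; apply/val_inj.
have I00 : (1 : 'M[R]_2) 0 0 = 1 by rewrite mxE.
have I01 : (1 : 'M[R]_2) 0 1 = 0 by rewrite mxE.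
have I10 : (1 : 'M[R]_2) 1 0 = 0 by rewrite mxE.
have I11 : (1 : 'M[R]_2) 1 1 = 1 by rewrite mxE.
have mxE' := (mx2_mulE, mxDE, mxZE, E00, E01, E10, E11, I00, I01, I10, I11).
apply: (@GammaLie_pinfty_of_exp x v s) => //.
- move=> i; rewrite /mxtrace /sqnorm !sum_mx2E /x.
  by case: (i == ord0); rewrite /= !mxE'; split; lra.
- move=> i; apply/matrixP => p q; rewrite /x; case: (i == ord0) => /=.
    by case: (oE p) => ->; case: (oE q) => ->; rewrite !mxE'; lra.
  by case: (oE p) => ->; case: (oE q) => ->; rewrite /= !mxE'; lra.
- rewrite /mxtrace sum_mx2E x0 x1 -/k !mxE'.
  (* Since tr (X Y) = -(a^2 + b^2) / 2 = -v^2 / 2, the identity [kv] makes the trace 2 cos^2 s - 2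
     (1 + cos^2 s) = -2. *)
  transitivity (2 * cos s ^+ 2 - k ^+ 2 * (a ^+ 2 + b ^+ 2) / 2); first by field.
  by rewrite a2 b2; lra.
(* The entry (0, 1) of E is -k a (cos s + k b / 2), nonzero because cos s > 0. *)
- apply/eqP => /matrixP/(_ 0 1); rewrite x0 x1 -/k !mxE' mxE I01 oppr0.
  move=> e; have : 0 < k * a * (cos s + k * b / 2).
    have kb : 0 <= k * b by rewrite mulr_ge0// ltW.
    apply: mulr_gt0; first exact: mulr_gt0.
    by apply: (lt_le_trans c0); rewrite lerDl divr_ge0.
  rewrite [X in 0 < X](_ : _ = 0) ?ltxx//.
  by apply: oppr_inj; rewrite oppr0 -[RHS]e; field.
Qed.

End Divergence.

(** * The minimal value *)

Section CosTaylor.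
Variable R : realType.

Lemma MVT_is_derive (f df : R -> R) (a b : R) : a <= b ->
  (forall x, a <= x <= b -> is_derive x 1 f (df x)) ->
  exists2 c, a <= c <= b & f b - f a = df c * (b - a).
Proof.
move=> ab fdf.
have [||c cab fab] := @MVT_segment R f df a b ab.
- by move=> x /[!in_itv] /= /andP[/ltW ax /ltW xb]; apply: fdf; rewrite ax.
- apply: derivable_within_continuous => x /[!in_itv] /= xab.
  by have [] := fdf x xab.
by exists c => //; move: cab; rewrite in_itv.
Qed.

Lemma ge0_of_derive (f df : R -> R) :
  f 0 = 0 -> (forall x : R, is_derive x 1 f (df x)) ->
  (forall x, 0 <= x -> 0 <= df x) -> forall x, 0 <= x -> 0 <= f x.
Proof.
move=> f0 fdf df0 x x0.
have [c /andP[c0 _]] := MVT_is_derive x0 (fun z _ => fdf z).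
by rewrite f0 !subr0 => ->; rewrite mulr_ge0// df0.
Qed.

Definition cosp n : {poly R} :=
  \sum_(k < n) ((-1) ^+ k / k.*2`!%:R) *: 'X^(k.*2).

Definition sinp n : {poly R} :=
  \sum_(k < n) ((-1) ^+ k / k.*2.+1`!%:R) *: 'X^(k.*2.+1).

Let deriv_term (c : R) n :
  (c / n.+1`!%:R *: 'X^(n.+1))^`() = c / n`!%:R *: 'X^n :> {poly R}.
Proof.
rewrite linearZ /= derivXn -[X in _ *: X]scaler_nat scalerA; congr (_ *: _).
rewrite factS natrM invfM mulrA mulrAC mulfVK//.
Qed.

Lemma deriv_sinp n : (sinp n)^`() = cosp n.
Proof. by rewrite raddf_sum; apply: eq_bigr => k _; exact: deriv_term. Qed.

Lemma deriv_cosp n : (cosp n.+1)^`() = - sinp n.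
Proof.
rewrite /cosp big_ord_recl derivD linearZ /= derivXn mulr0n scaler0 add0r.
rewrite raddf_sum -sumrN; apply: eq_bigr => k _.
by rewrite [LHS]deriv_term [(-1) ^+ _]exprS mulN1r mulNr scaleNr.
Qed.

Lemma horner0_sinp n : (sinp n).[0] = 0.
Proof.
by rewrite horner_sum big1// => k _; rewrite hornerZ hornerXn expr0n mulr0.
Qed.

Lemma horner0_cosp n : (cosp n.+1).[0] = 1.
Proof.
rewrite horner_sum big_ord_recl big1 => [|k _].
  by rewrite hornerZ hornerXn expr0 invr1 !mulr1 addr0.
by rewrite hornerZ hornerXn expr0n mulr0.
Qed.

(** Starting from cos <= 1, each bound for cos integrates to one for sin, which integrates to the
    next one for cos. *)
Lemma cos_taylor n x : 0 <= x -> 0 <= (-1) ^+ n.+1 * (cos x - (cosp n.+1).[x]).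
Proof.
elim: n x => [|n IH] x x0.
  rewrite /cosp big_ord_recl big_ord0 addr0 expr0 invr1 mulr1 hornerZ hornerXn.
  by rewrite expr0 mulr1 expr1 mulN1r opprB subr_ge0 cos_le1.
have sin_taylor y : 0 <= y -> 0 <= (-1) ^+ n.+1 * (sin y - (sinp n.+1).[y]).
  move: y; apply: (@ge0_of_derive (fun y => (-1) ^+ n.+1 * (sin y - (sinp n.+1).[y]))
    (fun y => (-1) ^+ n.+1 * (cos y - (cosp n.+1).[y]))).
  - by rewrite sin0 horner0_sinp subrr mulr0.
  - by move=> z; rewrite -deriv_sinp; apply: is_deriveZ.
  - exact: IH.
move: x x0; apply: (@ge0_of_derive (fun y => (-1) ^+ n.+2 * (cos y - (cosp n.+2).[y]))
  (fun y => (-1) ^+ n.+1 * (sin y - (sinp n.+1).[y]))) => //.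
- by rewrite cos0 horner0_cosp subrr mulr0.
- move=> z; rewrite (_ : _ * _ = (-1) ^+ n.+2 * (- sin z - (- sinp n.+1).[z])).
    by rewrite -deriv_cosp; apply: is_deriveZ.
  by rewrite hornerN -opprD mulrN [in RHS]exprS mulN1r mulNr opprK.
Qed.

Definition cos_term n x : R := (-1) ^+ n / n.*2`!%:R * x ^+ n.*2.

Lemma horner_cosp_rec n x : (cosp n.+1).[x] = (cosp n).[x] + cos_term n x.
Proof. by rewrite /cosp big_ord_recr hornerD hornerZ hornerXn. Qed.

Lemma cos_term_rec n x : cos_term n.+1 x =
  - cos_term n x * (x ^+ 2 / (n.*2.+1%:R * n.*2.+2%:R)).
Proof.
rewrite /cos_term doubleS exprS 2!factS !natrM !exprS expr0.
move: ((-1) ^+ n) (x ^+ n.*2) => a b.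
by field; rewrite nat1r -natrD !pnatr_eq0 -!lt0n fact_gt0.
Qed.

End CosTaylor.

Section CosNumerics.
Variable R : realType.
Implicit Types x : R.

(** The nested form has only products of two consecutive integers as denominators, hence no large
    factorial as a numeral. *)
Lemma horner_cosp7 x : (cosp R 7).[x] = 1 - x ^+ 2 / 2 * (1 - x ^+ 2 / 12 *
  (1 - x ^+ 2 / 30 * (1 - x ^+ 2 / 56 * (1 - x ^+ 2 / 90 * (1 - x ^+ 2 / 132))))).
Proof.
rewrite !horner_cosp_rec !cos_term_rec /cosp big_ord0 horner0 /double /=.
have -> : cos_term 0 x = 1 by rewrite /cos_term expr0 invr1 !mulr1.
by field.
Qed.

Lemma horner_cosp8 x : (cosp R 8).[x] = 1 - x ^+ 2 / 2 * (1 - x ^+ 2 / 12 *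
  (1 - x ^+ 2 / 30 * (1 - x ^+ 2 / 56 * (1 - x ^+ 2 / 90 * (1 - x ^+ 2 / 132 *
  (1 - x ^+ 2 / 182)))))).
Proof.
rewrite !horner_cosp_rec !cos_term_rec /cosp big_ord0 horner0 /double /=.
have -> : cos_term 0 x = 1 by rewrite /cos_term expr0 invr1 !mulr1.
by field.
Qed.

Lemma cos_le_cosp7 x : 0 <= x -> cos x <= (cosp R 7).[x].
Proof.
by move=> /(cos_taylor 6); rewrite -signr_odd /= expr1 mulN1r opprB subr_ge0.
Qed.

Lemma cos_ge_cosp8 x : 0 <= x -> (cosp R 8).[x] <= cos x.
Proof.
by move=> /(cos_taylor 7); rewrite -signr_odd /= expr0 mul1r subr_ge0.
Qed.

Lemma cos_ge_cosp2 x : 0 <= x -> 1 - x ^+ 2 / 2 <= cos x.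
Proof.
move=> /(cos_taylor 1); rewrite -signr_odd /= expr0 mul1r subr_ge0.
rewrite !horner_cosp_rec !cos_term_rec /cosp big_ord0 horner0 /double /=.
have -> : cos_term 0 x = 1 by rewrite /cos_term expr0 invr1 !mulr1.
lra.
Qed.

(** The eighth Taylor term at 78/79 is about 10^-11, well below the width 10^-10 of the
    enclosure. *)
Lemma cos_78_79 : 5509 / 10 ^+ 4 + 1026 / 10 ^+ 8 + 69 / 10 ^+ 10 <=
  cos (78 / 79 : R) <= 5509 / 10 ^+ 4 + 1026 / 10 ^+ 8 + 70 / 10 ^+ 10.
Proof.
apply/andP; split.
  by apply: le_trans (cos_ge_cosp8 _); rewrite ?horner_cosp8; lra.
by apply: le_trans (cos_le_cosp7 _) _; rewrite ?horner_cosp7; lra.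
Qed.

End CosNumerics.

(** * The function to minimize, in the angle s = arccos delta *)

Section MinimalValue.
Variable R : realType.
Implicit Types (c s x : R).

Definition qcos s : R := Num.sqrt (1 + cos s ^+ 2).

(** [vMi_fun] at delta = cos s, for 0 < s < pi / 2. *)
Definition vfun s : R := s / sin s * (2 * qcos s).

(* For sin s > 0, [gap c s >= 0] means [c <= vfun s]. *)
Definition gap c s : R := s - c / 2 * (sin s / qcos s).

Lemma qcos_gt0 s : 0 < qcos s.
Proof. by rewrite sqrtr_gt0 ltr_wpDr// sqr_ge0. Qed.

Lemma qcos_sqr s : qcos s ^+ 2 = 1 + cos s ^+ 2.
Proof. by rewrite sqr_sqrtr// addr_ge0// sqr_ge0. Qed.

Lemma is_derive_qcos x : is_derive x 1 qcos (- cos x * sin x / qcos x).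
Proof.
rewrite /qcos.
have q0 : 0 < 1 + cos x ^+ 2 by rewrite ltr_wpDr// sqr_ge0.
have dq : is_derive x 1 (fun s : R => 1 + cos s ^+ 2) (- 2 * cos x * sin x).
  by apply: is_derive_eq; rewrite add0r /GRing.scale /=; ring.
have := @is_derive1_comp R Num.sqrt (fun s => 1 + cos s ^+ 2) x _ _
  (is_derive1_sqrt q0) dq.
move=> dsq; apply: (is_derive_eq dsq); rewrite /GRing.scale /= -/(qcos x).
by field; rewrite gt_eqF// qcos_gt0.
Qed.

(** The derivative of sin / qcos is cos (qcos^2 + sin^2) / qcos^3, and qcos^2 + sin^2 = 2. *)
Lemma is_derive_gap c x :
  is_derive x 1 (gap c) (1 - c * cos x / qcos x ^+ 3).
Proof.
have q0 := qcos_gt0 x; have dq := is_derive_qcos x.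
have dqV : is_derive x 1 (fun s => (qcos s)^-1) (cos x * sin x / qcos x ^+ 3).
  have := @is_deriveV _ qcos x _ 1 (lt0r_neq0 q0) dq.
  move=> dV; apply: (is_derive_eq dV); rewrite /GRing.scale /=.
  by field; rewrite gt_eqF.
have dsq : is_derive x 1 (fun s => sin s / qcos s)
    (cos x / qcos x + cos x * sin x ^+ 2 / qcos x ^+ 3).
  have dM := @is_deriveM _ _ (@sin R) (fun s => (qcos s)^-1) x 1 _ _
    (is_derive_sin x) dqV.
  apply: (is_derive_eq dM); rewrite /GRing.scale /=.
  by field; rewrite gt_eqF.
have dZ := @is_deriveZ _ _ _ _ (c / 2) x 1 _ dsq.
have dB := @is_deriveB _ _ _ (fun s : R => s) _ x 1 _ _ (is_derive_id _ _) dZ.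
apply: (is_derive_eq dB); rewrite /GRing.scale /=; congr (1 - _).
rewrite sin2cos2.
have -> : cos x / qcos x = cos x * qcos x ^+ 2 / qcos x ^+ 3.
  by field; rewrite gt_eqF.
rewrite qcos_sqr.
by field; rewrite gt_eqF.
Qed.

Lemma ler_cos_pihalf x y : 0 <= x -> x <= y -> y <= pi / 2 ->
  0 <= cos y <= cos x.
Proof.
move=> x0 xy yp; have p0 := @pi_gt0 R; apply/andP; split.
  by apply: cos_ge0_pihalf; rewrite yp andbT; lra.
move: xy; rewrite le_eqVlt => /predU1P[->//|xy].
by rewrite ltW// ltr_cos// in_itv /=; lra.
Qed.

Lemma ler_cos2_pihalf x y : 0 <= x -> x <= y -> y <= pi / 2 ->
  cos y ^+ 2 <= cos x ^+ 2.
Proof.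
move=> x0 xy yp; have /andP[y0 cyx] := ler_cos_pihalf x0 xy yp.
by rewrite ler_sqr// nnegrE// (le_trans y0).
Qed.

Lemma gap0 c : gap c 0 = 0.
Proof. by rewrite /gap sin0 mul0r mulr0 subr0. Qed.

(** Mean value theorem with slope at least -e; the last hypothesis is this slope bound, squared so
    as to be polynomial in cos^2 x. *)
Lemma gap_lower c e a b : 0 < c -> 0 <= e -> 0 <= a -> a <= b -> b <= pi / 2 ->
  (forall x, a <= x <= b ->
     c ^+ 2 * cos x ^+ 2 <= (1 + e) ^+ 2 * (1 + cos x ^+ 2) ^+ 3) ->
  gap c a - e * (b - a) <= gap c b.
Proof.
move=> c0 e0 a0 ab bp cosP.
have [x /andP[ax xb] gapab] := MVT_is_derive ab (fun x _ => is_derive_gap c x).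
suff h : - e <= 1 - c * cos x / qcos x ^+ 3.
  have := ler_wpM2r (_ : 0 <= b - a) h; rewrite -gapab subr_ge0 => /(_ ab).
  by rewrite mulNr; lra.
have q0 := qcos_gt0 x.
have /andP[cx0 _] := ler_cos_pihalf a0 ax (le_trans xb bp).
suff : c * cos x / qcos x ^+ 3 <= 1 + e by lra.
rewrite ler_pdivrMr ?exprn_gt0// -ler_sqr ?nnegrE; last 2 first.
- by rewrite mulr_ge0// ltW.
- by rewrite mulr_ge0 ?exprn_ge0 ?addr_ge0// ltW.
rewrite [(c * _) ^+ 2]exprMn [((1 + e) * _) ^+ 2]exprMn exprAC qcos_sqr; apply: cosP.
by rewrite ax.
Qed.

Lemma gap_upper c a b : 0 < c -> 0 <= a -> a <= b -> b <= pi / 2 ->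
  (forall x, a <= x <= b -> (1 + cos x ^+ 2) ^+ 3 <= c ^+ 2 * cos x ^+ 2) ->
  gap c b <= gap c a.
Proof.
move=> c0 a0 ab bp cosP.
have [x /andP[ax xb] gapab] := MVT_is_derive ab (fun x _ => is_derive_gap c x).
rewrite -subr_le0 gapab mulr_le0_ge0 ?subr_ge0// subr_le0.
have q0 := qcos_gt0 x.
have /andP[cx0 _] := ler_cos_pihalf a0 ax (le_trans xb bp).
rewrite ler_pdivlMr ?exprn_gt0// mul1r -ler_sqr ?nnegrE; last 2 first.
- by rewrite exprn_ge0// ltW.
- by rewrite mulr_ge0// ltW.
by rewrite [(c * _) ^+ 2]exprMn exprAC qcos_sqr; apply: cosP; rewrite ax.
Qed.

(* The sign of the derivative of [gap c] is that of [(1 + u) ^+ 3 - c ^+ 2 * u]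
   at [u = cos x ^+ 2], a convex function of [u]. *)
Lemma convex_cubic (a w u d : R) : 0 <= a -> a <= w -> w <= u ->
  (1 + a) ^+ 3 <= d * a -> (1 + u) ^+ 3 <= d * u -> (1 + w) ^+ 3 <= d * w.
Proof.
move=> a0 aw wu ha hu.
have [->//|ua] := eqVneq w u.
have au : 0 < u - a by rewrite subr_gt0 (le_lt_trans aw)// lt_neqAle ua.
rewrite -subr_ge0 -(pmulr_rge0 _ au).
(* The last summand is the defect in the chord inequality for the cube. *)
rewrite (_ : (u - a) * _ = (u - w) * (d * a - (1 + a) ^+ 3) +
  (w - a) * (d * u - (1 + u) ^+ 3) +
  (u - a) * ((u - w) * (w - a) * (u + a + w + 3))); last by ring.
by rewrite !addr_ge0 ?mulr_ge0//; lra.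
Qed.

(** By convexity the slope of [gap c] is nonpositive for an interval of values of cos^2. If cos^2 s
    lies in it, [gap c] decreases from [s] to [a] and stays above [gap c a]; otherwise the slope is
    nonnegative on [0, s] and [gap c] starts from 0. *)
Lemma gap_ge0_left c a s : 0 < c -> a <= pi / 2 ->
  (1 + cos a ^+ 2) ^+ 3 <= c ^+ 2 * cos a ^+ 2 -> 0 <= gap c a ->
  0 <= s <= a -> 0 <= gap c s.
Proof.
move=> c0 ap ha ga /andP[s0 sa].
have [hs|hs] := leP ((1 + cos s ^+ 2) ^+ 3) (c ^+ 2 * cos s ^+ 2).
  apply: le_trans ga _; apply: gap_upper => // x /andP[sx xa].
  apply: convex_cubic ha hs; first exact: sqr_ge0.
    by apply: ler_cos2_pihalf => //; exact: le_trans sx.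
  by apply: ler_cos2_pihalf => //; exact: le_trans ap.
have := @gap_lower c 0 0 s c0 (lexx _) (lexx _) s0 (le_trans sa ap).
rewrite gap0 mul0r subr0; apply => x /andP[x0 xs].
rewrite addr0 expr1n mul1r leNgt; apply/negP => hx.
move: hs; rewrite ltNge => /negP; apply.
apply: convex_cubic ha (ltW hx); first exact: sqr_ge0.
  by apply: ler_cos2_pihalf => //.
by apply: ler_cos2_pihalf => //; exact: le_trans ap.
Qed.

Lemma vfun_ge c s : 0 < sin s -> 0 <= gap c s -> c <= vfun s.
Proof.
move=> s0; have q0 := qcos_gt0 s; rewrite /gap /vfun subr_ge0 => h.
have := ler_wpM2r (_ : 0 <= 2 * qcos s / sin s) h.
rewrite (_ : c / 2 * _ * _ = c); last by field; rewrite !gt_eqF.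
rewrite [X in _ -> _ <= X](_ : _ = s * (2 * qcos s / sin s)); last first.
  by field; rewrite gt_eqF.
by apply; rewrite divr_ge0// ?mulr_ge0// ltW.
Qed.

End MinimalValue.

Section Digits.
Variable R : realType.
Implicit Types (c s x : R).

(* Decimals are sums of short fractions, and enter the proofs through variables,
   because numerals are unary. The minimizer lies between sa and sb; cl and cu
   enclose cos sa, and ck bounds cos sb from above. *)
Variables sa sb cL cU cl cu ck : R.
Hypotheses (saE : sa = 78 / 79) (sbE : sb = 4937 / 5000)
  (cLE : cL = 2701 / 10 ^+ 3 + 4285 / 10 ^+ 7)
  (cUE : cU = 2701 / 10 ^+ 3 + 4285 / 10 ^+ 7 + 5 / 10 ^+ 8)
  (clE : cl = 5509 / 10 ^+ 4 + 1026 / 10 ^+ 8 + 69 / 10 ^+ 10)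
  (cuE : cu = 5509 / 10 ^+ 4 + 1026 / 10 ^+ 8 + 70 / 10 ^+ 10)
  (ckE : ck = 5508 / 10 ^+ 4 + 7 / 10 ^+ 5).

Lemma cos_sqr_sa : cl ^+ 2 <= cos sa ^+ 2 <= cu ^+ 2.
Proof.
have := cos_78_79 R; rewrite -saE -clE -cuE => /andP[lo hi].
have c0 : 0 <= cl by rewrite clE; lra.
have cs0 := le_trans c0 lo.
by rewrite !ler_sqr ?nnegrE ?lo ?hi ?(le_trans cs0 hi).
Qed.

Lemma pihalf_gt : 7 / 5 < (pi / 2 : R).
Proof.
rewrite ltNge; apply/negP => pi7.
have c7 : 0 < cos (7 / 5 : R).
  apply: lt_le_trans (cos_ge_cosp8 _); last by lra.
  by rewrite horner_cosp8; lra.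
have p0 := @pi_ge2 R.
have : cos (7 / 5) <= cos (pi / 2 : R).
  move: pi7; rewrite le_eqVlt => /predU1P[->//|pi7].
  by apply/ltW; rewrite ltr_cos// in_itv /=; lra.
by rewrite cos_pihalf leNgt c7.
Qed.

(** A (1 + u)^3 - d u is nonincreasing on [0, u0] once its derivative at [u0] is nonpositive, so its
    sign at [u0] suffices. *)
Lemma cubic_ge (d A u u0 : R) : 0 <= u -> u <= u0 -> 0 <= A ->
  A * (3 * (1 + u0) ^+ 2) <= d -> d * u0 <= A * (1 + u0) ^+ 3 ->
  d * u <= A * (1 + u) ^+ 3.
Proof.
move=> u_ge0 uu0 A0 hA hd.
have h : A * ((1 + u) ^+ 2 + (1 + u) * (1 + u0) + (1 + u0) ^+ 2) <= d.
  apply: le_trans hA; rewrite ler_wpM2l//.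
  rewrite [leRHS](_ : _ =
    (1 + u0) ^+ 2 + (1 + u0) * (1 + u0) + (1 + u0) ^+ 2); last by ring.
  by rewrite lerD2r lerD ?lerXn2r ?nnegrE ?ler_wpM2r//; lra.
rewrite -subr_ge0 (_ : _ - _ = (A * (1 + u0) ^+ 3 - d * u0) + (u0 - u) *
  (d - A * ((1 + u) ^+ 2 + (1 + u) * (1 + u0) + (1 + u0) ^+ 2))); last by ring.
by rewrite addr_ge0 ?mulr_ge0// subr_ge0.
Qed.

(** The left side is the most that [gap cL] can lose from [sa] to [sb] at slope -2/10^5. Squaring
    reduces the claim to a polynomial inequality in cos^2 sa. *)
Lemma gap_sa : 2 / 10 ^+ 5 * (sb - sa) <= gap cL sa.
Proof.
have /andP[lo _] := cos_sqr_sa.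
have q0 := qcos_gt0 sa.
have s0 : 0 < sin sa.
  by apply: sin_gt0_pihalf; have := pihalf_gt; rewrite saE; lra.
set h := 2 / 10 ^+ 5 * (sb - sa).
have hE : h = 2 / 10 ^+ 5 * (4937 / 5000 - 78 / 79) by rewrite /h saE sbE.
rewrite /gap lerBrDr -lerBrDl.
have -> : cL / 2 * (sin sa / qcos sa) = cL * sin sa / (2 * qcos sa).
  by field; rewrite gt_eqF.
have sh : 0 <= sa - h by rewrite hE saE; lra.
rewrite ler_pdivrMr ?mulr_gt0// -ler_sqr ?nnegrE; last 2 first.
- by rewrite mulr_ge0 ?ltW// cLE; lra.
- by rewrite !mulr_ge0// ltW.
rewrite 3!exprMn qcos_sqr sin2cos2.
by move: lo; move: (cos sa ^+ 2) => u; rewrite cLE hE saE clE; lra.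
Qed.

(** Up to [sa], [gap_ge0_left] applies; between [sa] and [sb] the slope is at least -2/10^5, a loss
    covered by [gap_sa]; beyond [sb] the slope is nonnegative. *)
Lemma gap_ge0 s : 0 <= s -> s <= pi / 2 -> 0 <= gap cL s.
Proof.
move=> s0 sp.
have pi7 := pihalf_gt.
have /andP[lo hi] := cos_sqr_sa.
have cL0 : 0 < cL by rewrite cLE; lra.
have gsa := gap_sa.
have sa0 : 0 <= sa by rewrite saE; lra.
have sap : sa <= pi / 2 by rewrite saE; lra.
have sb0 : 0 <= sb by rewrite sbE; lra.
have sbp : sb <= pi / 2 by rewrite sbE; lra.
have sab : sa <= sb by rewrite saE sbE; lra.
have [ssa|/ltW sas] := leP s sa.
  apply: (gap_ge0_left cL0 sap); last by rewrite s0.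
    by move: lo hi; move: (cos sa ^+ 2) => u; rewrite cLE clE cuE; nra.
  by apply: le_trans gsa; rewrite mulr_ge0 ?subr_ge0//; lra.
have mid t : sa <= t -> t <= sb ->
    gap cL sa - 2 / 10 ^+ 5 * (t - sa) <= gap cL t.
  move=> sat tsb; apply: gap_lower => //; first by lra.
  move=> x /andP[sax xt]; apply: (@cubic_ge _ _ _ (cos sa ^+ 2)).
  - exact: sqr_ge0.
  - by apply: ler_cos2_pihalf => //; apply: le_trans xt _; exact: le_trans tsb sbp.
  - exact: sqr_ge0.
  - by move: lo hi; move: (cos sa ^+ 2) => u; rewrite cLE clE cuE; nra.
  - by move: lo hi; move: (cos sa ^+ 2) => u; rewrite cLE clE cuE; nra.
have [ssb|/ltW sbs] := leP s sb.
  apply: le_trans (mid s sas ssb); rewrite subr_ge0; apply: le_trans gsa.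
  by rewrite ler_wpM2l ?lerD2r//; lra.
have gsb : 0 <= gap cL sb.
  by apply: le_trans (mid sb sab (lexx _)); rewrite subr_ge0.
apply: le_trans gsb _.
have := @gap_lower _ cL 0 sb s cL0 (lexx _) sb0 sbs sp.
rewrite mul0r subr0; apply => x /andP[sbx xs]; rewrite addr0 expr1n.
have /andP[cb0 _] := ler_cos_pihalf sb0 (lexx _) sbp.
have cb : cos sb <= ck.
  apply: le_trans (cos_le_cosp7 sb0) _; rewrite horner_cosp7 sbE ckE; lra.
have cb2 : cos sb ^+ 2 <= ck ^+ 2 by rewrite ler_sqr ?nnegrE ?(le_trans cb0).
apply: (@cubic_ge _ _ _ (ck ^+ 2)) => //.
- exact: sqr_ge0.
- by apply: le_trans cb2; apply: ler_cos2_pihalf => //; exact: le_trans xs sp.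
- by rewrite cLE ckE; lra.
- by rewrite cLE ckE; lra.
Qed.

Lemma vfun_lower s : 0 < s < pi / 2 -> cL <= vfun s.
Proof.
move=> /andP[s0 sp]; apply: vfun_ge.
  by apply: sin_gt0_pihalf; rewrite s0.
by apply: gap_ge0; rewrite ltW.
Qed.

Lemma vfun_sa : vfun sa < cU.
Proof.
have /andP[_ hi] := cos_sqr_sa.
have q0 := qcos_gt0 sa.
have s0 : 0 < sin sa.
  by apply: sin_gt0_pihalf; have := pihalf_gt; rewrite saE; lra.
rewrite /vfun mulrAC ltr_pdivrMr// -ltr_sqr ?nnegrE; last 2 first.
- by rewrite !mulr_ge0 ?ltW// saE; lra.
- by rewrite mulr_ge0 ?ltW// cUE; lra.
rewrite 3!exprMn qcos_sqr sin2cos2.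
move: hi; move: (cos sa ^+ 2) => u hi; rewrite saE cUE; move: hi; rewrite cuE; lra.
Qed.

(** Near 0, u = cos^2 is close to 1 and (1 + u)^3 >= cU^2 u, so [gap cU] increases from 0; near pi /
    2, sin / qcos <= 1 while s >= 7/5 > cU / 2. This confines the minimum to a compact interval. *)
Lemma vfun_outside s : 0 < s < pi / 2 -> s <= 1 / 4 \/ 7 / 5 <= s -> cU <= vfun s.
Proof.
move=> /andP[s0 sp] out.
have cU0 : 0 < cU by rewrite cUE; lra.
have p0 := pihalf_gt.
have sins : 0 < sin s by apply: sin_gt0_pihalf; rewrite s0.
apply: vfun_ge => //; case: out => hs.
  have := @gap_lower _ cU 0 0 s cU0 (lexx _) (lexx _) (ltW s0) (ltW sp).
  rewrite gap0 mul0r subr0; apply => x /andP[x0 xs].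
  rewrite addr0 expr1n mul1r.
  have cx : 31 / 32 <= cos x.
    by apply: le_trans (cos_ge_cosp2 x0); nra.
  have cx1 := cos_le1 x.
  have : 15 / 16 <= cos x ^+ 2 by nra.
  have : cos x ^+ 2 <= 1 by nra.
  by move: (cos x ^+ 2) => u u1 u2; rewrite cUE; nra.
rewrite /gap subr_ge0; apply: le_trans hs.
have q1 : sin s / qcos s <= 1.
  rewrite ler_pdivrMr ?qcos_gt0// mul1r; apply: le_trans (sin_le1 _) _.
  by rewrite -[leLHS]sqrtr1 ler_wsqrtr// lerDl sqr_ge0.
by rewrite cUE; nra.
Qed.

End Digits.

(** * Existence of the minimum *)

Section MinimumAttained.
Variable R : realType.
Implicit Types s t : R.

Lemma derivable_vfun s : 0 < s < pi / 2 -> derivable (@vfun R) s 1.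
Proof.
move=> /andP[s0 sp]; have sin0 : 0 < sin s by apply: sin_gt0_pihalf; rewrite s0.
have [dq _] := is_derive_qcos s.
apply: derivableM; first apply: derivableM => //.
  by apply: derivableV; rewrite ?gt_eqF.
exact: derivableM.
Qed.

Lemma vMi_fun_cos s : 0 < s < pi / 2 -> vMi_fun (cos s) = vfun s.
Proof.
move=> /andP[s0 sp]; have p0 := @pi_gt0 R.
have sin0 : 0 < sin s by apply: sin_gt0_pihalf; rewrite s0.
rewrite /vMi_fun /vfun cosK; last by rewrite in_itv /=; lra.
by rewrite -sin2cos2 sqrtr_sqr gtr0_norm.
Qed.

Lemma acos_pihalf (delta : R) : 0 < delta < 1 -> 0 < acos delta < pi / 2.
Proof.
move=> /andP[d0 d1]; rewrite acos_gt0; last by rewrite d1 andbT; lra.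
have dI : -1 <= delta <= 1 by lra.
have p0 := @pi_gt0 R.
rewrite ltNge; apply/negP => h.
suff : delta <= 0 by rewrite leNgt d0.
rewrite -[delta]acosK; last by rewrite in_itv.
rewrite -(@cos_pihalf R); move: h; rewrite le_eqVlt => /predU1P[<-//|h].
by apply/ltW; rewrite ltr_cos// in_itv /= ?acos_ge0 ?acos_lepi//; lra.
Qed.

(** The extreme value theorem gives a minimum on [1/4, 7/5]; outside, the values are at least [cU],
    which exceeds the value at 78/79. *)
Lemma vfun_attained (cU : R) : cU = 2701 / 10 ^+ 3 + 4285 / 10 ^+ 7 + 5 / 10 ^+ 8 ->
  exists s, [/\ 0 < s < pi / 2, forall t, 0 < t < pi / 2 -> vfun s <= vfun t &
  vfun s < cU].
Proof.
move=> cUE; have p7 := pihalf_gt R.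
have [||s sI smin] := @EVT_min R (@vfun R) (1 / 4) (7 / 5).
- by lra.
- apply: derivable_within_continuous => x; rewrite in_itv /= => xI.
  by apply: derivable_vfun; lra.
move: sI; rewrite in_itv /= => sI.
have sa_lt : vfun (78 / 79 : R) < cU by exact: (vfun_sa erefl cUE erefl).
have s_le : vfun s <= vfun (78 / 79 : R) by apply: smin; rewrite in_itv /=; lra.
exists s; split; [by lra| |exact: le_lt_trans sa_lt].
move=> t tI; have [t1|t1] := leP t (1 / 4).
  apply: le_trans s_le (le_trans (ltW sa_lt) _).
  by apply: (vfun_outside cUE) => //; left.
have [t2|t2] := leP (7 / 5) t.
  apply: le_trans s_le (le_trans (ltW sa_lt) _).
  by apply: (vfun_outside cUE) => //; right.
by apply: smin; rewrite in_itv /= !ltW.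
Qed.

End MinimumAttained.

(** * The convergence radii *)

Section Radii.
Variable R : realType.

Lemma GammaLie_le (x y : R) : 0 <= x -> x <= y -> (GammaLie x x <= GammaLie y y)%E.
Proof.
move=> x0 xy; have y0 := le_trans x0 xy.
apply: le_esum => -[n1 n2] _ /=; apply: lee_wpmul2l; first exact: lie_l1norm_ge0.
by rewrite lee_fin -!exprD lerXn2r.
Qed.

Lemma CLie2_le_DLie2 : (CLie2 R <= DLie2 R)%E.
Proof.
apply: ge_ereal_sup => _ [x [x0 Gx] <-]; apply: ereal_sup_ubound.
exists x => //; split=> //; apply: le_lt_trans Gx.
apply: ereal_sup_ubound; exists (x / 2, x / 2) => //=.
by split=> /=; lra.
Qed.

Lemma DLie2_le (v : R) : 0 < v -> GammaLie v v = +oo%E -> (DLie2 R <= (2 * v)%:E)%E.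
Proof.
move=> v0 Gv; apply: ge_ereal_sup => _ [x [x0 Gx] <-].
rewrite lee_fin leNgt; apply/negP => vx.
have := @GammaLie_le v (x / 2) (ltW v0); rewrite Gv leye_eq.
have -> : v <= x / 2 by lra.
by move=> /(_ isT)/eqP Goo; rewrite Goo ltxx in Gx.
Qed.

End Radii.

Theorem corollary3p4 (R : realType) :
  exists vMi : R,
    [/\ is_minimum [set vMi_fun delta | delta in [set delta : R | 0 < delta < 1]] vMi,
        decimal_digits [:: 2; 7; 0; 1; 4; 2; 8; 5]%N vMi,
        GammaLie vMi vMi = +oo%E,
        (CLie2 R <= DLie2 R <= (2 * vMi)%:E)%E &
        decimal_digits [:: 5; 4; 0; 2; 8; 5; 7; 0]%N (2 * vMi)].
Proof.
(* The constants come from existentials so as to stay opaque variables. [cU] exceeds [cL] by half a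
   unit of the seventh decimal, because the doubled value must also be known to seven decimals. *)
have [cU cUE] : exists c : R, c = 2701 / 10 ^+ 3 + 4285 / 10 ^+ 7 + 5 / 10 ^+ 8.
  by eexists.
have [cL cLE] : exists c : R, c = 2701 / 10 ^+ 3 + 4285 / 10 ^+ 7 by eexists.
have [s [sI smin sU]] := vfun_attained cUE.
have sL : cL <= vfun s := vfun_lower erefl erefl cLE erefl erefl erefl sI.
have Goo := GammaLie_pinfty sI; rewrite /= -/(vfun s) in Goo.
have v0 : 0 < vfun s by apply: lt_le_trans sL; rewrite cLE; lra.
exists (vfun s); split=> //.
- split.
    exists (cos s); last exact: vMi_fun_cos.
    case/andP: sI => s0 sp; have p0 := @pi_gt0 R.
    rewrite /= cos_gt0_pihalf ?sp ?andbT; last by lra.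
    by rewrite -(@cos0 R) ltr_cos// in_itv /=; lra.
  move=> _ [delta dI <-]; have aI := acos_pihalf dI.
  rewrite -[delta]acosK; last by rewrite in_itv /=; case/andP: dI; lra.
  by rewrite vMi_fun_cos// smin.
- rewrite /decimal_digits /decimal !big_ord_recl big_ord0 /=.
  by move: sL sU; rewrite cLE cUE; lra.
- by rewrite CLie2_le_DLie2 DLie2_le.
- rewrite /decimal_digits /decimal !big_ord_recl big_ord0 /=.
  by move: sL sU; rewrite cLE cUE; lra.
Qed.
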